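(* Let $n\ge 1$ and let $X_n=\{x_0,x_1,\dots,x_n\}\subset F$, where $F$ is Thompson's group. For every $g\in F$, the word length $l_n(g)$ of $g$ with respect to the generating set $X_n$ is given by the formula $$l_n(g)=l_\infty(g)+2p_n(g),$$ where $l_\infty(g)$ is the number of carets in the reduced tree pair diagram for $g$ which are not right carets (counted over both trees of the pair), and $p_n(g)$ is the penalty weight (penalty contribution) of $g$.
   Context: **Group.** Thompson's group is $F=\langle x_k,\ k\ge 0\mid x_i^{-1}x_jx_i=x_{j+1}\text{ if } i<j\rangle$. For $n\ge1$ the set $X_n=\{x_0,\dots,x_n\}$ generates $F$. **Trees and carets.** Trees are finite rooted binary trees with at least one caret. A caret is a vertex together with two downward edges, its left and right edges. The left (right) child of a caret $c$ is the caret attached to the lower end of its left (right) edge, if there is one; otherwise that end is a leaf. The left (right) side of a tree is the maximal path of left (right) edges beginning at the root caret. A caret is a left (right) caret if one of its edges lies on the left (right) side; the root caret counts as both a left and a right caret (in particular the root is a right caret and is not counted in $l_\infty$). A caret that is neither left nor right is interior. Carets of a tree with $N$ carets are numbered $1,\dots,N$ in infix order (all carets in the left subtree of $c$, then $c$, then all carets in the right subtree of $c$) and are named by these numbers; leaves are numbered $0,\dots,N$ from left to right. **Tree pair diagrams.** A tree pair diagram is a pair $(T_-,T_+)$ of trees with the same number of carets. It is unreduced if for some $i$ both trees contain a caret both of whose ends are leaves, numbered $i,i+1$; removing such pairs of carets repeatedly gives a reduced diagram. The leaf exponent $E(k)$ of leaf $k$ in a tree is the length of the longest upward path of left edges starting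 at leaf $k$ that does not reach the right side of the tree (so edges with an endpoint on the right side, including the root vertex, are not used). A reduced diagram $(T_-,T_+)$ represents the element $x_0^{E_+(0)}x_1^{E_+(1)}\cdots x_N^{E_+(N)}\,x_N^{-E_-(N)}\cdots x_1^{-E_-(1)}x_0^{-E_-(0)}$, where $E_\pm$ are the leaf exponents in $T_\pm$; every element of $F$ is represented by a unique reduced tree pair diagram. Writing $g=(T_-,T_+)$ means that this is the reduced diagram of $g$. The identity is represented by the pair of one-caret trees. ''Caret $p$'' of $(T_-,T_+)$ means the pair of carets numbered $p$ in $T_-$ and $T_+$. **Penalty carets.** Caret $p$ in a tree $T$ has type $N$ if caret $p+1$ exists, is an interior caret, and lies in the right subtree of $p$. Caret $p$ of $(T_-,T_+)$ is a penalty caret if either (1) $p$ has type $N$ in $T_-$ or in $T_+$, or (2) $p$ is a right caret in both $T_-$ and $T_+$ and $p$ is not the final (highest-numbered) caret. **Adjacency.** In a tree, the generalized left edge of a caret $c$ consists of the left edge of $c$ together with the right edges of all carets on the path that starts at the left child of $c$ and repeatedly passes to right children. The generalized right edge of $c$ consists of the right edge of $c$ together with the left edges of all carets on the path that starts at the right child of $c$ and repeatedly passes to left children. For carets $p<q$ of $(T_-,T_+)$, write $p\prec q$ if in $T_-$ or in $T_+$ some caret edge is part of both the generalized right edge of $p$ and the generalized left edge of $q$. (Always $p\prec p+1$; the relation is not transitive.) There is also a dummy caret $v_0$ (number $0$), with $v_0\prec q$ exactly when $q$ is a left caret in $T_-$ or in $T_+$. **Penalty trees.** A penalty tree $\mathcal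 P$ for $g=(T_-,T_+)$ is a rooted tree with root $v_0$, with edges directed away from the root, such that: (i) its vertices are $v_0$ and a subset of the carets of $(T_-,T_+)$; (ii) if there is a directed edge from $p$ to $q$ then $p\prec q$; (iii) every penalty caret is a vertex; (iv) every leaf (vertex with no outgoing edge) is a penalty caret, the only exception being when $\mathcal P$ consists only of $v_0$. If there is a directed path in $\mathcal P$ between two vertices $p,q$, $d_{\mathcal P}(p,q)$ denotes its number of edges. **Penalty weight.** A vertex $v$ of $\mathcal P$ is weighted (with respect to $n$) if $d_{\mathcal P}(v_0,v)\ge 2$ and there is a leaf $l$ of $\mathcal P$, equal to $v$ or a descendant of $v$, with $d_{\mathcal P}(v,l)\ge n-1$. $p_n(\mathcal P)$ is the number of weighted vertices of $\mathcal P$, and $p_n(g)=\min\{p_n(\mathcal P)\mid \mathcal P \text{ is a penalty tree for } g\}$. *)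

(* Defs.v *)
From HB Require Import structures.
From mathcomp Require Import all_boot generic_quotient.
From mathcomp Require Import boolp classical_sets.
Set Implicit Arguments.
Unset Strict Implicit.
Unset Printing Implicit Defensive.

(* The value 0 for the empty set is a convention only: the sets to which this is
   applied below, for X_n with n >= 1, are nonempty. *)
Definition least (A : nat -> Prop) : nat :=
  if pselect (exists k, `[< A k >]) is left exA then ex_minn exA else 0.

(* The letter (i, false) is x_i and (i, true) is x_i^-1. *)
Definition letter : Type := (nat * bool)%type.
Definition word : Type := seq letter.

(* The congruence on words generated by free cancellation and by the
   relations x_i^-1 x_j x_i = x_(j+1), i < j. *)
Inductive word_cong : word -> word -> Prop :=
| word_cong_refl w : word_cong w w
| word_cong_sym u v : word_cong u v -> word_cong v u
| word_cong_trans u v w : word_cong u v -> word_cong v w -> word_cong u w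
| word_cong_cat u u' v v' :
    word_cong u u' -> word_cong v v' -> word_cong (u ++ v) (u' ++ v')
| word_cong_cancel i b : word_cong [:: (i, b); (i, ~~ b)] [::]
| word_cong_rel i j : i < j ->
    word_cong [:: (i, true); (j, false); (i, false)] [:: (j.+1, false)].

Definition inv_letter (a : letter) : letter := (a.1, ~~ a.2).
Definition inv_word (w : word) : word := rev (map inv_letter w).

Lemma word_cong_mulV w : word_cong (w ++ inv_word w) [::].
Proof.
elim: w => [|[i b] w IHw]; first exact: word_cong_refl.
rewrite /inv_word /= rev_cons -cats1 -/(inv_word w) catA.
apply: word_cong_trans (word_cong_cancel i b).
apply: (@word_cong_cat [:: (i, b)] [:: (i, b)] _ [:: (i, ~~ b)]).
  exact: word_cong_refl.
exact: (@word_cong_cat _ [::]) IHw (word_cong_refl _).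
Qed.

Lemma inv_wordK : involutive inv_word.
Proof.
move=> w; rewrite /inv_word map_rev revK -map_comp -[RHS]map_id.
by apply: eq_map => -[i b]; rewrite /inv_letter /= negbK.
Qed.

Lemma word_cong_mulVl w : word_cong (inv_word w ++ w) [::].
Proof. by have := word_cong_mulV (inv_word w); rewrite inv_wordK. Qed.

Lemma word_cong_inv u v : word_cong u v -> word_cong (inv_word u) (inv_word v).
Proof.
move=> uv; apply: (@word_cong_trans _ (inv_word u ++ (v ++ inv_word v))).
  rewrite -[X in word_cong X _]cats0; apply: word_cong_cat.
    exact: word_cong_refl.
  exact/word_cong_sym/word_cong_mulV.
rewrite catA -[X in word_cong _ X]cat0s.
apply: word_cong_cat (word_cong_refl _).
apply: word_cong_trans (word_cong_mulVl u).
by apply: word_cong_cat; [exact: word_cong_refl | exact: word_cong_sym].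
Qed.

Definition word_congb (u v : word) : bool := `[< word_cong u v >].

Lemma word_congb_refl : reflexive word_congb.
Proof. by move=> w; apply/asboolP/word_cong_refl. Qed.

Lemma word_congb_sym : symmetric word_congb.
Proof. by move=> u v; apply/asboolP/asboolP; apply: word_cong_sym. Qed.

Lemma word_congb_trans : transitive word_congb.
Proof.
by move=> v u w /asboolP uv /asboolP vw; apply/asboolP/(word_cong_trans uv vw).
Qed.

Canonical word_cong_equiv :=
  EquivRel word_congb word_congb_refl word_congb_sym word_congb_trans.

Definition ThompsonF : Type := {eq_quot word_cong_equiv}%qT.
HB.instance Definition _ := Choice.on ThompsonF.
HB.instance Definition _ := EqQuotient.on ThompsonF.

Local Open Scope quotient_scope.

Lemma ThompsonF_eqP (u v : word) :
  \pi_ThompsonF u = \pi_ThompsonF v <-> word_cong u v.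
Proof.
by split=> [/eqmodP/asboolP | uv]; last exact/eqmodP/asboolP.
Qed.

Lemma ThompsonF_surj (g : ThompsonF) : exists u : word, g = \pi_ThompsonF u.
Proof. by exists (repr g); rewrite reprK. Qed.

Definition Fone : ThompsonF := \pi_ThompsonF [::].
Definition Fmul (g h : ThompsonF) : ThompsonF := \pi_ThompsonF (repr g ++ repr h).
Definition Finv (g : ThompsonF) : ThompsonF := \pi_ThompsonF (inv_word (repr g)).

Lemma Fmul_pi u v :
  Fmul (\pi_ThompsonF u) (\pi_ThompsonF v) = \pi_ThompsonF (u ++ v).
Proof.
by apply/ThompsonF_eqP; apply: word_cong_cat; apply/ThompsonF_eqP; rewrite reprK.
Qed.

Lemma Finv_pi u : Finv (\pi_ThompsonF u) = \pi_ThompsonF (inv_word u).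
Proof.
by apply/ThompsonF_eqP/word_cong_inv/ThompsonF_eqP; rewrite reprK.
Qed.

Lemma FmulA : associative Fmul.
Proof.
move=> f g h; have [u ->] := ThompsonF_surj f.
have [v ->] := ThompsonF_surj g; have [w ->] := ThompsonF_surj h.
by rewrite !Fmul_pi catA.
Qed.

Lemma Fmul1g : left_id Fone Fmul.
Proof. by move=> g; have [u ->] := ThompsonF_surj g; rewrite Fmul_pi. Qed.

Lemma Fmulg1 : right_id Fone Fmul.
Proof. by move=> g; have [u ->] := ThompsonF_surj g; rewrite Fmul_pi cats0. Qed.

Lemma FmulVg : left_inverse Fone Finv Fmul.
Proof.
move=> g; have [u ->] := ThompsonF_surj g; rewrite Finv_pi Fmul_pi.
exact/ThompsonF_eqP/word_cong_mulVl.
Qed.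

Lemma FmulgV : right_inverse Fone Finv Fmul.
Proof.
move=> g; have [u ->] := ThompsonF_surj g; rewrite Finv_pi Fmul_pi.
exact/ThompsonF_eqP/word_cong_mulV.
Qed.

HB.instance Definition _ :=
  isGroup.Build ThompsonF FmulA Fmul1g Fmulg1 FmulVg FmulgV.

Definition xgen (i : nat) : ThompsonF := \pi_ThompsonF [:: (i, false)].

Lemma xgen_rel i j : i < j ->
  ((xgen i)^-1 * xgen j * xgen i)%g = xgen j.+1.
Proof.
move=> ij; change (Fmul (Fmul (Finv (xgen i)) (xgen j)) (xgen i) = xgen j.+1).
by rewrite /xgen Finv_pi !Fmul_pi; apply/ThompsonF_eqP/word_cong_rel.
Qed.

Local Close Scope quotient_scope.

Definition Xgens (n : nat) : ThompsonF -> Prop :=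
  fun y => exists2 i, i <= n & y = xgen i.

Definition word_length_for (G : groupType) (S : G -> Prop) (g : G) : nat :=
  least (fun k => exists s : seq G,
    [/\ size s = k, forall y, y \in s -> S y \/ S (y^-1)%g
      & (\prod_(y <- s) y)%g = g]).

Definition word_length (n : nat) (g : ThompsonF) : nat :=
  word_length_for (Xgens n) g.

Inductive tree : Type :=
| Leaf
| Caret of tree & tree.

Fixpoint tree_encode (t : tree) : GenTree.tree unit :=
  if t is Caret l r then GenTree.Node 0 [:: tree_encode l; tree_encode r]
  else GenTree.Leaf tt.

Fixpoint tree_decode (t : GenTree.tree unit) : tree :=
  if t is GenTree.Node _ [:: l; r] then Caret (tree_decode l) (tree_decode r)
  else Leaf.

Lemma tree_encodeK : cancel tree_encode tree_decode.
Proof. by elim=> //= l -> r ->. Qed.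

HB.instance Definition _ := Countable.copy tree (can_type tree_encodeK).

(* A vertex of a tree is identified with the sequence of edges leading to it
   from the root: false for a left edge, true for a right edge.  An edge is
   identified with its lower end, so the edges of the caret c are
   rcons c false (left) and rcons c true (right). *)
Definition address : Type := seq bool.

Fixpoint carets (t : tree) : seq address :=
  if t is Caret l r then
    map (cons false) (carets l) ++ [::] :: map (cons true) (carets r)
  else [::].

Fixpoint leaves (t : tree) : seq address :=
  if t is Caret l r then
    map (cons false) (leaves l) ++ map (cons true) (leaves r)
  else [:: [::]].

Definition ncarets (t : tree) : nat := size (carets t).

Definition edges (t : tree) : seq address :=
  flatten [seq [:: rcons c false; rcons c true] | c <- carets t].

(* Carets are numbered from 1, leaves from 0. *)
Definition is_caret (t : tree) (p : nat) : bool := 0 < p <= ncarets t.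
Definition caret (t : tree) (p : nat) : address := nth [::] (carets t) p.-1.
Definition leaf (t : tree) (k : nat) : address := nth [::] (leaves t) k.

Definition on_left_side (v : address) : bool := all negb v.
Definition on_right_side (v : address) : bool := all id v.

Definition left_caret (t : tree) (p : nat) : bool :=
  is_caret t p && on_left_side (caret t p).
Definition right_caret (t : tree) (p : nat) : bool :=
  is_caret t p && on_right_side (caret t p).
Definition interior_caret (t : tree) (p : nat) : bool :=
  [&& is_caret t p, ~~ left_caret t p & ~~ right_caret t p].

Definition in_right_subtree (t : tree) (p q : nat) : bool :=
  prefix (rcons (caret t p) true) (caret t q).

Definition exposed_at (t : tree) (i : nat) : bool :=
  has (fun c => (leaf t i == rcons c false) && (leaf t i.+1 == rcons c true))
    (carets t).

(* Number of left edges of the longest upward path of left edges from the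
   vertex whose reversed address is r, using no edge with upper end on the
   right side (the lower end of a left edge is never on the right side). *)
Fixpoint up_left_length (r : seq bool) : nat :=
  if r is false :: r' then
    if on_right_side r' then 0 else (up_left_length r').+1
  else 0.

Definition leaf_exponent (t : tree) (k : nat) : nat :=
  up_left_length (rev (leaf t k)).

(* A pair (T_-, T_+). *)
Definition diagram : Type := (tree * tree)%type.

Definition is_diagram (d : diagram) : bool :=
  (0 < ncarets d.1) && (ncarets d.1 == ncarets d.2).

Definition identity_diagram : diagram := (Caret Leaf Leaf, Caret Leaf Leaf).

(* The pair of one-caret trees is reduced although its two carets match:
   a tree has at least one caret, so they cannot be removed. *)
Definition reduced (d : diagram) : Prop :=
  is_diagram d /\
  (d = identity_diagram \/ forall i, ~ (exposed_at d.1 i /\ exposed_at d.2 i)).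

Definition diagram_element (d : diagram) : ThompsonF :=
  let ks := iota 0 (ncarets d.1).+1 in
  ((\prod_(k <- ks) xgen k ^+ leaf_exponent d.2 k)
   * \prod_(k <- rev ks) xgen k ^- leaf_exponent d.1 k)%g.

(* The reduced diagram of g; the default is immaterial, since every element
   has exactly one. *)
Definition reduced_diagram (g : ThompsonF) : diagram :=
  xget identity_diagram (fun d => reduced d /\ diagram_element d = g).

Definition nonright_carets (t : tree) : nat :=
  count (fun c => ~~ on_right_side c) (carets t).

Definition l_infty (g : ThompsonF) : nat :=
  nonright_carets (reduced_diagram g).1 + nonright_carets (reduced_diagram g).2.

Definition type_N (t : tree) (p : nat) : bool :=
  [&& is_caret t p, is_caret t p.+1, interior_caret t p.+1
    & in_right_subtree t p p.+1].

Definition penalty_caret (d : diagram) (p : nat) : bool :=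
  [|| type_N d.1 p, type_N d.2 p
    | [&& right_caret d.1 p, right_caret d.2 p & p != ncarets d.1]].

(* The generalized left edge (b = false) or right edge (b = true) of the caret
   c: the b-edge of c, then edges in the other direction only. *)
Definition generalized_edge (t : tree) (c : address) (b : bool) : seq address :=
  [seq e <- edges t |
    prefix (rcons c b) e && all (pred1 (~~ b)) (drop (size c).+1 e)].

Definition adjacent_in (t : tree) (p q : nat) : bool :=
  has (mem (generalized_edge t (caret t q) false))
    (generalized_edge t (caret t p) true).

(* The relation p -< q; the number 0 is the dummy caret v_0. *)
Definition adjacent (d : diagram) (p q : nat) : bool :=
  if p == 0 then left_caret d.1 q || left_caret d.2 q
  else [&& is_caret d.1 p, is_caret d.1 q, p < q
         & adjacent_in d.1 p q || adjacent_in d.2 p q].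

Record digraph (V : finType) : Type := Digraph {
  verts : {set V};
  arc : rel V
}.

Section Digraph.
Variables (V : finType) (P : digraph V).

Definition dpath (p q : V) (s : seq V) : Prop :=
  path (arc P) p s /\ last p s = q.

(* Edges directed away from the root r: every vertex is reached from r by
   exactly one directed path. *)
Definition rooted_tree (r : V) : Prop :=
  [/\ r \in verts P,
      forall p q, arc P p q -> p \in verts P /\ q \in verts P
    & forall v, v \in verts P -> exists! s, dpath r v s].

Definition tree_leaf (v : V) : Prop :=
  v \in verts P /\ forall w, ~~ arc P v w.

(* There is a directed path from p to q and d_P(p, q) >= m. *)
Definition dist_ge (p q : V) (m : nat) : Prop :=
  exists2 s, dpath p q s & m <= size s.

End Digraph.

(* Vertices are numbered 0, ..., N: the dummy caret v_0 and the carets. *)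
Definition caret_digraph (d : diagram) : Type :=
  digraph 'I_(ncarets d.1).+1.

Definition penalty_tree (d : diagram) (P : caret_digraph d) : Prop :=
  [/\ rooted_tree P ord0,
      forall p q, arc P p q -> adjacent d p q,
      forall p : 'I_(ncarets d.1).+1, penalty_caret d p -> p \in verts P
    & verts P = [set ord0]%SET \/ forall l, tree_leaf P l -> penalty_caret d l].

Definition weighted (n : nat) (d : diagram) (P : caret_digraph d)
    (v : 'I_(ncarets d.1).+1) : Prop :=
  [/\ v \in verts P, dist_ge P ord0 v 2
    & exists2 l, tree_leaf P l & dist_ge P v l (n - 1)].

Definition tree_penalty_weight (n : nat) (d : diagram) (P : caret_digraph d) :
    nat :=
  #|[pred v | `[< weighted n P v >]]|.

Definition diagram_penalty_weight (n : nat) (d : diagram) : nat :=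
  least (fun k => exists P : caret_digraph d,
    penalty_tree P /\ tree_penalty_weight n P = k).

Definition penalty_weight (n : nat) (g : ThompsonF) : nat :=
  diagram_penalty_weight n (reduced_diagram g).

(* Main.v *)
Require Import Defs.
From mathcomp Require Import all_boot boolp zify.
Set Implicit Arguments.
Unset Strict Implicit.
Unset Printing Implicit Defensive.

(** Cutting a tree along its right side leaves a forest: the left subtrees of
    its right carets.  Caret p sits in the gap before leaf p; record a caret of
    the forest that covers the leaves a, ..., b - 1 as the arc (a, b).  Then
    caret p is a right caret iff no arc jumps over p (p is exposed), it has type N
    iff an arc starts at p, and p -< q holds iff q = p + 1 or (p, q) is an arc of
    one of the two forests.  So a diagram (T_-, T_+) is a pair of forests (A, B),
    l_infty is its number of arcs, and a penalty tree is a map par with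
    par y -< y, of which one keeps the ancestors of the penalty vertices.  Its weighted vertices are the heavy ones:
    the par^m(p) with p a penalty vertex and m >= n - 1, apart from the root and
    its children.

    Let 0 = r_0 < r_1 < ... be the exposed vertices of A.  Multiplying on the
    right by x_i^-1 adds the arc (r_i, r_(i+2)) to A.  Multiplying by x_i removes
    the arc (r_i, r_(i+1)); if the i-th tree of A is a leaf, it instead inserts a
    leaf in A and splits the leaf r_i of B.  Cancelling a common exposed caret
    undoes this last move.  Let L be the number of arcs plus twice the least
    number of heavy vertices.

    Lower bound.  A generator x_i with i <= n changes L by at most 1
    ([length_step]).  The number of arcs changes by one.  Adding an arc does not
    increase the weight, since the path r_0, ..., r_i can be woven into the
    penalty tree without new heavy vertices ([add_path], [weight_le_join]).
    Removing an arc (u, x) over v costs at most one heavy vertex, since it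
    suffices to replace the edge u x by the path u v x ([subdivide],
    [weight_le_split]).  Inserting a leaf and cancelling do not increase the
    weight.  Only the pair without arcs represents 1 ([trivial_pair]), so a word
    for g has at least L(g) letters.

    Upper bound.  If there is an arc, some generator lowers L
    ([weight_descent]).  Follow r_0, r_1, ... as long as the steps are edges of
    an optimal penalty tree.  If they all are up to r_(n+1), then r_2 is heavy;
    the new arc (0, r_2) makes it a child of the root, which saves 2 for one
    letter.  Otherwise the walk stops at some r_i with i <= n.  If the i-th tree
    of A is not a leaf, its top arc is used nowhere in the penalty tree and can be
    removed.  If it is a leaf, planarity forces the arc (r_i, r_i + 2) in B, and
    x_i^-1 cancels it. *)

(** * Parent maps and their heavy vertices *)

Section ParentFunctions.
Variable n : nat.

(** Some descendant of [w] that satisfies [penalty] lies at distance at least [m]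
    below [w]: the vertices that do not descend to a penalty vertex are ignored,
    as they can be pruned from the tree. *)
Definition height_ge (penalty : nat -> Prop) (par : nat -> nat) (w m : nat) : Prop :=
  exists2 p, penalty p & exists2 k, m <= k & iter k par p = w.

(** The second condition says that [w] is neither the root nor one of its
    children, since [par 0 = 0]. *)
Definition heavy (penalty : nat -> Prop) (par : nat -> nat) (w : nat) : Prop :=
  height_ge penalty par w n.-1 /\ par w <> 0.

Lemma height_ge_le penalty par w m k : m <= k -> height_ge penalty par w k -> height_ge penalty par w m.
Proof.
by move=> mk [p pp [j kj <-]]; exists p => //; exists j => //; apply: leq_trans kj.
Qed.

Lemma height_ge_step penalty par w m :
  height_ge penalty par w m -> height_ge penalty par (par w) m.+1.
Proof. by move=> [p pp [j mj <-]]; exists p => //; exists j.+1. Qed.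

Lemma height_ge_iter penalty par w m k :
  height_ge penalty par w m -> height_ge penalty par (iter k par w) (k + m).
Proof. by elim: k => //= k IH /IH/height_ge_step. Qed.

Lemma height_ge_penalty penalty par p : penalty p -> height_ge penalty par p 0.
Proof. by exists p => //; exists 0. Qed.

(** Call [r j] light when it has height less than [n - j], and hang each light
    [r j] below [r j.-1].  The new paths then reach [r j] in at most [n - j] steps
    as long as they run through light vertices, and the first vertex after them that is
    not light was at least that high before.  So no new vertex becomes heavy: the
    only light vertex that a path of length [n.-1] can reach is [r 1], which is a
    child of the root. *)
Lemma add_path penalty par r i :
    i <= n -> par 0 = 0 -> r 0 = 0 -> injective r ->
  exists2 par' : nat -> nat,
    forall y, par' y = par y \/ exists2 j, j < i & y = r j.+1 /\ par' y = r j
  & forall w, heavy (fun p => penalty p \/ exists2 j, 0 < j <= i & p = r j) par' w ->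
      heavy penalty par w.
Proof.
move=> le_in par0 r0 inj_r.
pose light j := ~ height_ge penalty par (r j) (n - j).
pose pickj y := [pick j : 'I_i | (y == r j.+1) && `[< light j.+1 >]].
pose par' y := if pickj y is Some j then r j else par y.
pose heavyside v := forall j, 0 < j <= i -> v = r j -> ~ light j.
have par'E y : par' y = par y /\ heavyside y
    \/ exists2 j, j < i & [/\ y = r j.+1, light j.+1 & par' y = r j].
  rewrite /par' /pickj; case: pickP => [j /andP[/eqP-> /asboolP lj] | none].
    by right; exists j.
  left; split=> // -[//|j] /= lt_ji yj lj.
  by have := none (Ordinal lt_ji); rewrite /= yj eqxx /=; case: asboolP.
exists par' => [y|w].
  by case: (par'E y) => [[-> _]|[j ji [-> _ ->]]]; [left | right; exists j].
pose settled v m := [\/ v = 0,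
  exists2 j, 0 < j <= i & [/\ v = r j, light j & m <= n - j]
  | heavyside v /\ height_ge penalty par v m].
have settle v k : height_ge penalty par v k -> settled v k.
  move=> rv; case: (pselect (exists2 j, 0 < j <= i & v = r j /\ light j)).
    move=> [j ji [vj lj]]; apply: Or32; exists j => //; split=> //.
    rewrite leqNgt; apply/negP => lt_k; apply: lj.
    by rewrite -vj; apply: height_ge_le rv; apply: ltnW.
  by move=> nl; apply: Or33; split=> // j ji vj lj; apply: nl; exists j.
have step v m : settled v m -> settled (par' v) m.+1.
  case=> [->|[j ji [vj lj mj]]|[hv rv]].
  - apply: Or31; case: (par'E 0) => [[-> _] //|[j _ []]].
    by rewrite -r0 => /inj_r.
  - case: (par'E v) => [[_ /(_ j ji vj)] //|[j' j'i [vj' _ ->]]].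
    have ej : j = j'.+1 by apply: inj_r; rewrite -vj.
    case: (posnP j') => [->|j'0]; first exact: Or31.
    have mj' : m.+1 <= n - j'.
      by apply: leq_ltn_trans mj _; rewrite ej ltn_sub2l // (leq_trans j'i).
    case: (pselect (light j')) => lj'.
      by apply: Or32; exists j'; rewrite // j'0 ltnW.
    by apply: settle; apply: height_ge_le mj' _; apply: contrapT.
  - case: (par'E v) => [[-> _]|[j' j'i [vj' lj' _]]]; first exact/settle/height_ge_step.
    by case: (hv j'.+1).
have start p : (penalty p \/ exists2 j, 0 < j <= i & p = r j) -> settled p 0.
  case=> [pp|[j ji ->]]; first exact/settle/height_ge_penalty.
  case: (pselect (light j)) => lj; first by apply: Or32; exists j.
  by apply: settle; apply: (@height_ge_le _ _ _ _ (n - j)) => //; apply: contrapT.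
have inv p m : (penalty p \/ exists2 j, 0 < j <= i & p = r j) ->
    settled (iter m par' p) m.
  by move=> pp; elim: m => [|m]; [apply: start | apply: step].
move=> [[p pp [k nk kw]] nz].
case: (par'E w) (inv p k pp) => [[parw hw]|[j ji [wj lj parw]]]; rewrite kw.
  case=> [w0|[j ji [wj lj _]]|[_ rw]]; first by rewrite parw w0 par0 in nz.
    by case: (hw j).
  by split; [apply: height_ge_le rw | rewrite -parw].
case=> [w0|[j' j'i [wj' _ kj]]|[hw _]]; last by case: (hw j.+1).
  by move: wj; rewrite w0 -r0 => /inj_r.
have ej : j' = j.+1 by apply: inj_r; rewrite -wj'.
have j0 : j = 0.
  apply/eqP; rewrite -leqn0 leqNgt; apply/negP => j0.
  by move: kj nk ji j0 le_in; rewrite ej; lia.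
by rewrite parw j0 r0 in nz.
Qed.

Lemma height_bounded penalty par x M : par 0 = 0 -> (forall y, 0 < y -> par y < y) ->
  (forall p, penalty p -> p <= M) -> 0 < x -> ~ height_ge penalty par x M.+1.
Proof.
move=> par0 par_lt penM x0 [p /penM pM [k kM kx]].
have H j : 0 < iter j par p -> j + iter j par p <= p.
  elim: j => //= j IH pos.
  have pj : 0 < iter j par p by case: (posnP (iter j par p)) pos => // ->; rewrite par0.
  by have := par_lt _ pj; have := IH pj; lia.
by have := H k; rewrite kx; lia.
Qed.

(** Replacing the edge [u x] by the path [u v x] lengthens by one the paths that
    run through [x].  If [v] is already as high as it has to be, [x] can simply
    move below [v], and only [x] may become heavy, by leaving the root.
    Otherwise [v] moves below [u].  Along the ancestors of [u] the heights
    strictly increase towards the root, so at most one of them, or else [v],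
    crosses the threshold [n.-1]. *)
Lemma subdivide penalty par u v x M :
    par 0 = 0 -> (forall y, 0 < y -> par y < y) ->
    (forall p, penalty p -> p <= M) -> u < v < x -> u = 0 \/ height_ge penalty par u 0 ->
  exists2 par' : nat -> nat,
    forall y, [\/ par' y = par y /\ ~ (y = x /\ par x = u),
                  y = v /\ par' y = u | y = x /\ par' y = v]
  & exists z, forall w, heavy (fun p => penalty p \/ p = v) par' w ->
      heavy penalty par w \/ w = z.
Proof.
move=> par0 par_lt penM /andP[uv vx] uV.
have x0 : 0 < x by lia.
(* Every path from a penalty vertex that moves along with x reaches x in
   fewer than e steps. *)
have [e xe ue] : exists2 e, par x = u -> forall m, height_ge penalty par x m -> m < e
    & u = 0 \/ height_ge penalty par u e.
  case: (eqVneq (par x) u) => [pxu|/eqP pxu]; last by exists 0.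
  have ex : exists m, ~~ `[< height_ge penalty par x m >].
    by exists M.+1; apply/asboolPn/height_bounded.
  case: (ex_minnP ex) => e /asboolPn ne min; exists e => [_ m rm|].
    by rewrite ltnNge; apply/negP => em; apply: ne; apply: height_ge_le em rm.
  case: e ne min => [|e] _ min //; right; rewrite -pxu; apply: height_ge_step.
  by apply: contrapT => /asboolPn /min; rewrite ltnn.
have lt_iter j y : iter j par y <= y.
  elim: j => //= j IH; case: (posnP (iter j par y)) => [->|/par_lt]; lia.
(* If v is at least as high as required by its new child x, its own parent is kept. *)
have [rv|nrv] := pselect (height_ge penalty par v e).
  pose par' y := if (y == x) && (par x == u) then v else par y.
  exists par' => [y|].
    rewrite /par'; case: (eqVneq y x) => [->|/eqP yx] /=; last by apply: Or31; split=> // -[].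
    case: (eqVneq (par x) u) => [//|/eqP pxu]; first by move=> _; apply: Or33.
    by apply: Or31; split=> // -[].
  exists x => w [[p pp [k nk kw]] nz].
  have inv m : height_ge penalty par (iter m par' p) m.
    elim: m => [|m IH] /=.
      by case: pp => [/(height_ge_penalty par)|->] //; apply: height_ge_le rv.
    rewrite {1}/par'; case: ifP => [/andP[/eqP Ex /eqP pxu]|_]; last exact: height_ge_step.
    by apply: height_ge_le rv; apply: xe pxu _ _; rewrite -Ex.
  case: (eqVneq w x) => [->|wx]; [by right | left; split].
    by rewrite -kw; apply: height_ge_le (inv k).
  by move: nz; rewrite /par' (negPf wx).
pose par' y := if y == v then u
  else if (y == x) && (par x == u) then v else par y.
exists par' => [y|].
  rewrite /par'; case: (eqVneq y v) => [->|_]; first exact: Or32.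
  case: (eqVneq y x) => [->|/eqP yx] /=; last by apply: Or31; split=> // -[].
  case: (eqVneq (par x) u) => [//|/eqP pxu]; first by move=> _; apply: Or33.
  by apply: Or31; split=> // -[].
have par'_v : par' v = u by rewrite /par' eqxx.
have par'_low y : y <= u -> par' y = par y.
  by move=> yu; rewrite /par'; do 2 (case: eqP => [|_]; first by lia).
have inv p m : (penalty p \/ p = v) -> let w := iter m par' p in
    [\/ w = v /\ m <= e, w <> v /\ height_ge penalty par w m
      | exists2 j, w = iter j par u & m <= e.+1 + j].
  move=> pp; have settle y k : (y = v -> k <= e) -> height_ge penalty par y k ->
     [\/ y = v /\ k <= e, y <> v /\ height_ge penalty par y k
      | exists2 j, y = iter j par u & k <= e.+1 + j].
    by case: (eqVneq y v) => [-> /(_ erefl)|/eqP]; [move=> *; apply: Or31 | move=> *; apply: Or32].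
  elim: m => [|m] /=.
    case: pp => [/(height_ge_penalty par)|->]; first by apply: settle.
    exact: Or31.
  set y := iter m par' p; case=> [[-> me]|[yv ry]|[j yj mj]].
  - by rewrite par'_v; apply: Or33; exists 0; rewrite ?addn0.
  - rewrite /par' (introF eqP yv); case: ifP => [/andP[/eqP Ex /eqP pxu]|_].
      by apply: Or31; split=> //; apply: (xe pxu); rewrite -Ex.
    apply: settle; last exact: height_ge_step.
    move=> pyv; rewrite leqNgt; apply/negP => em; apply: nrv.
    by apply: height_ge_le (ltnW em) _; rewrite -pyv; apply: height_ge_step.
  - by apply: Or33; exists j.+1; rewrite ?addnS // yj par'_low.
(* The height of the j-th ancestor of u may grow from e + j to e + j + 1,
   which reaches n.-1 for one j only. *)
exists (if u == 0 then x else if n.-1 <= e then v else iter (n.-1 - e.+1) par u).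
move=> w [[p pp [k nk kw]] nz].
have {inv}:= inv p k pp; rewrite /= kw.
case: (eqVneq u 0) => [u0|u0].
  case=> [[wv _]|[wv rw]|[j wj _]].
  - by rewrite wv par'_v in nz.
  - case: (eqVneq w x) => [|wx]; [by right | left; split; first exact: height_ge_le rw].
    by move: nz; rewrite /par' (introF eqP wv) (negPf wx).
  - have w0 : w = 0 by apply/eqP; rewrite wj -leqn0 -u0 lt_iter.
    by rewrite w0 par'_low // par0 in nz.
case: ue => [/eqP ue|ue]; first by rewrite ue in u0.
case=> [[wv ke]|[wv rw]|[j wj kj]].
- by right; rewrite (leq_trans nk).
- left; split; first exact: height_ge_le rw.
  move: nz; rewrite /par' (introF eqP wv); case: ifP => // /andP[/eqP-> /eqP-> _].
  exact/eqP.
have parw : par w <> 0 by rewrite -par'_low // wj lt_iter.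
have [ne|ne] := leqP n.-1 (e + j).
  by left; split=> //; apply: height_ge_le ne _; rewrite wj addnC; apply: height_ge_iter.
right; rewrite leqNgt (leq_ltn_trans _ ne) ?leq_addr //= wj.
by congr (iter _ _ _); lia.
Qed.

End ParentFunctions.

Section Renumbering.
Variable n : nat.

Definition weight_le (penalty : nat -> Prop) (par : nat -> nat) (k : nat) : Prop :=
  exists2 s : seq nat, size s <= k & forall w, heavy n penalty par w -> w \in s.

Lemma weight_le_sub penalty par k penalty' par' k' : k <= k' ->
  (forall w, heavy n penalty' par' w -> heavy n penalty par w) ->
  weight_le penalty par k -> weight_le penalty' par' k'.
Proof.
by move=> kk sub [s sk sP]; exists s => [|w /sub/sP//]; apply: leq_trans kk.
Qed.

(** Contracting the edge from [q] to [q.+1] shortens paths, so that the heavy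
    vertices of the contracted map come from heavy vertices of [par]. *)
Lemma weight_le_contract penalty par penalty' q k :
    par q.+1 = q -> (forall p, penalty' p -> penalty (bump q.+1 p)) ->
  weight_le penalty par k ->
  weight_le penalty' (fun y => unbump q (par (bump q.+1 y))) k.
Proof.
move=> parq penalty'P [s sk sP]; set par' := fun y => _.
exists [seq unbump q w | w <- s] => [|w [[p /penalty'P pp [m nm mw]] nz]].
  by rewrite size_map.
have [m' mm' m'w] : exists2 m', m <= m' & iter m' par (bump q.+1 p) = bump q.+1 w.
  rewrite -mw; elim: {nm mw} m => [|m [m' mm' IH]] /=; first by exists 0.
  rewrite {1}/par' -IH -iterS; set z := iter m'.+1 par _.
  have [zq|/eqP zq] := eqVneq z q.+1.
    exists m'.+2; first by rewrite ltnS (leq_trans mm').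
    by rewrite iterS -/z zq parq /unbump /bump; lia.
  by exists m'.+1 => //; rewrite -/z /unbump /bump; lia.
have -> : w = unbump q (bump q.+1 w) by rewrite /unbump /bump; lia.
apply/map_f/sP; split.
  by exists (bump q.+1 p) => //; exists m' => //; apply: leq_trans mm'.
by move=> pw0; apply: nz; rewrite /par' pw0.
Qed.

Definition par_expand q (par : nat -> nat) y :=
  if y == q.+1 then q else bump q.+1 (par (unbump q.+1 y)).

Lemma weight_le_expand penalty par q k : weight_le penalty par k ->
  weight_le (fun p => exists2 p', penalty p' & p = bump q.+1 p') (par_expand q par) k.
Proof.
move=> [s sk sP]; exists [seq bump q.+1 w | w <- s] => [|w]; first by rewrite size_map.
move=> [[_ [p pp ->] [m nm <-]] nz].
have E y : par_expand q par (bump q.+1 y) = bump q.+1 (par y).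
  by rewrite /par_expand bumpK; case: eqP => // H; move: (neq_bump q.+1 y); rewrite H eqxx.
have {E}iterE j : iter j (par_expand q par) (bump q.+1 p) = bump q.+1 (iter j par p).
  by elim: j => //= j ->.
rewrite iterE map_f // sP //; split; first by exists p => //; exists m.
by move=> H; apply: nz; rewrite -iterS iterE /= H.
Qed.

End Renumbering.

(** * Pairs of arc systems *)

Definition edge (a : seq (nat * nat)) x y : bool := (y == x.+1) || ((x, y) \in a).
Definition adj (a b : seq (nat * nat)) x y : bool := edge a x y || edge b x y.
Definition starts (a : seq (nat * nat)) x : bool := has (fun e => e.1 == x) a.
Definition exposed (a : seq (nat * nat)) v : bool := all (fun e => ~~ (e.1 < v < e.2)) a.

Arguments starts : simpl never.
Arguments exposed : simpl never.

(** A vertex [p] exposed in both trees is the last caret of a reduced diagram iff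
    no arc starts at [p] or to its right; hence the last disjunct, which stands for right
    carets of both trees other than the final one. *)
Definition penalty (a b : seq (nat * nat)) p : bool :=
  (0 < p) && [|| starts a p, starts b p
    | [&& exposed a p, exposed b p & has (fun e => p < e.1) (a ++ b)]].

Definition parent_map (a b : seq (nat * nat)) (par : nat -> nat) : Prop :=
  par 0 = 0 /\ forall y, 0 < y -> adj a b (par y) y.

Definition pair_weight_le n (a b : seq (nat * nat)) k : Prop :=
  exists2 par, parent_map a b par & weight_le n (penalty a b) par k.

Lemma startsP a x : reflect (exists y, (x, y) \in a) (starts a x).
Proof.
apply: (iffP hasP) => [[[x' y] xy /= /eqP <-]|[y xy]]; first by exists y.
by exists (x, y).
Qed.

Lemma exposedP a v :
  reflect (forall x y, (x, y) \in a -> x < v -> v < y -> False) (exposed a v).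
Proof.
apply: (iffP allP) => [H x y /H /= /negP xy xv vy|H [x y] xy /=].
  by apply: xy; rewrite xv.
by apply/negP => /andP[xv vy]; apply: H xy xv vy.
Qed.

Lemma penalty_bounded a b : exists M, forall p, penalty a b p -> p <= M.
Proof.
exists (\max_(e <- a ++ b) e.1) => p /andP[_] H.
have: has (fun e => p <= e.1) (a ++ b).
  apply/hasP; case/or3P: H => [/hasP[e ee /eqP <-]|/hasP[e ee /eqP <-]|].
  - by exists e; rewrite // mem_cat ee.
  - by exists e; rewrite // mem_cat ee orbT.
  - by case/and3P => _ _ /hasP[e ee /ltnW pe]; exists e.
by case/hasP => e ee pe; apply: leq_trans pe _; apply: leq_bigmax_seq ee isT.
Qed.

(** * Forests and their arcs *)

Fixpoint nleaves (t : tree) : nat :=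
  if t is Caret l r then nleaves l + nleaves r else 1.

(** The leaf [k] lies between the gaps [k] and [k.+1], and [o] is the number of the
    first leaf of the tree. *)
Fixpoint tree_arcs o (t : tree) : seq (nat * nat) :=
  if t is Caret l r then
    (o, o + nleaves t) :: tree_arcs o l ++ tree_arcs (o + nleaves l) r
  else [::].

Fixpoint forest_arcs o (f : seq tree) : seq (nat * nat) :=
  if f is t :: f' then tree_arcs o t ++ forest_arcs (o + nleaves t) f' else [::].

(** The gap before the tree [i] of a forest; beyond its end, a forest continues
    with leaves. *)
Fixpoint bound (f : seq tree) i : nat :=
  if i is i'.+1 then nleaves (head Leaf f) + bound (behead f) i' else 0.

(** Left multiplication of a forest by the generator [xgen i]. *)
Fixpoint join i (f : seq tree) : seq tree :=
  if i is i'.+1 then head Leaf f :: join i' (behead f)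
  else Caret (nth Leaf f 0) (nth Leaf f 1) :: drop 2 f.

Fixpoint insert_leaf i (f : seq tree) : seq tree :=
  if i is i'.+1 then head Leaf f :: insert_leaf i' (behead f) else Leaf :: f.

Fixpoint tree_expand k (t : tree) : tree :=
  if t is Caret l r then
    if k < nleaves l then Caret (tree_expand k l) r
    else Caret l (tree_expand (k - nleaves l) r)
  else Caret Leaf Leaf.

Fixpoint forest_expand k (f : seq tree) : seq tree :=
  if f is t :: f' then
    if k < nleaves t then tree_expand k t :: f'
    else t :: forest_expand (k - nleaves t) f'
  else rcons (nseq k Leaf) (Caret Leaf Leaf).

Lemma nleaves_gt0 t : 0 < nleaves t.
Proof. by elim: t => //= l IHl r _; rewrite ltn_addr. Qed.

Lemma nleaves1 t : nleaves t = 1 -> t = Leaf.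
Proof.
by case: t => //= l r; have := nleaves_gt0 l; have := nleaves_gt0 r; lia.
Qed.

Lemma nleaves_head f : nleaves (head Leaf f) = bound f 1.
Proof. by case: f => [|t f] /=; rewrite addn0. Qed.

Lemma bound0 f : bound f 0 = 0.
Proof. by []. Qed.

Lemma boundD f i j : bound f (i + j) = bound f i + bound (drop i f) j.
Proof. by elim: i f => [|i IH] [|t f] //=; rewrite IH //= addnA. Qed.

Lemma boundS f i : bound f i.+1 = bound f i + nleaves (nth Leaf f i).
Proof. by rewrite -addn1 boundD /= addn0 -nth0 nth_drop addn0. Qed.

Lemma bound_cons t f i : bound (t :: f) i.+1 = nleaves t + bound f i.
Proof. by []. Qed.

Lemma bound_lt f i j : i < j -> bound f i < bound f j.
Proof.
elim: j => // j IH; rewrite ltnS boundS => ij.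
have := nleaves_gt0 (nth Leaf f j); move: ij; rewrite leq_eqVlt => /orP[/eqP->|/IH]; lia.
Qed.

Lemma bound_ltE f i j : (bound f i < bound f j) = (i < j).
Proof.
apply/idP/idP => [|/bound_lt //]; case: (ltngtP i j) => // [/(bound_lt f)|->]; lia.
Qed.

Lemma bound_inj f : injective (bound f).
Proof.
by move=> i j e; case: (ltngtP i j) => // /(@bound_lt f); rewrite e ltnn.
Qed.

Lemma tree_arcs_bounds o t x y :
  (x, y) \in tree_arcs o t -> [/\ o <= x, x.+2 <= y & y <= o + nleaves t].
Proof.
elim: t o => //= l IHl r IHr o; rewrite inE mem_cat => /or3P[/eqP[-> ->]|/IHl|/IHr] //.
- have := nleaves_gt0 l; have := nleaves_gt0 r; split; lia.
- by case; split=> //; lia.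
- by case; split=> //; lia.
Qed.

Lemma forest_arcs_bounds o f x y :
  (x, y) \in forest_arcs o f -> o <= x /\ x.+2 <= y.
Proof.
elim: f o => //= t f IH o; rewrite mem_cat => /orP[/tree_arcs_bounds[]|/IH[]] //.
by split=> //; lia.
Qed.

Lemma tree_arcs_noncrossing o t x y z w :
  (x, y) \in tree_arcs o t -> (z, w) \in tree_arcs o t -> x < z < y -> w <= y.
Proof.
elim: t o => //= l IHl r IHr o; rewrite !inE !mem_cat.
case/or3P => [/eqP[-> ->]|xy|xy]; case/or3P => [/eqP[-> ->]|zw|zw] // zy;
  try (move: (tree_arcs_bounds xy)); try (move: (tree_arcs_bounds zw)).
all: try (case=> ? ? ?); try (case=> ? ? ?); try lia.
  exact: IHl xy zw zy.
exact: IHr xy zw zy.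
Qed.

Lemma forest_arcs_noncrossing o f x y z w :
  (x, y) \in forest_arcs o f -> (z, w) \in forest_arcs o f -> x < z < y -> w <= y.
Proof.
elim: f o => //= t f IH o; rewrite !mem_cat => /orP[] xy /orP[] zw zy.
- exact: tree_arcs_noncrossing xy zw zy.
- by move: (tree_arcs_bounds xy) (forest_arcs_bounds zw) => -[? ? ?] [? ?]; lia.
- by move: (tree_arcs_bounds zw) (forest_arcs_bounds xy) => -[? ? ?] [? ?]; lia.
- exact: IH xy zw zy.
Qed.

Lemma tree_arcs_full o t : t <> Leaf -> (o, o + nleaves t) \in tree_arcs o t.
Proof. by case: t => //= l r _; rewrite inE eqxx. Qed.

(** The left subtree of a caret starts at the same leaf; the shortest arc from [x]
    has a single leaf as its left subtree, and its right subtree is a leaf or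
    gives an arc from [x.+1]. *)
Lemma tree_arc_ear o t x y : (x, y) \in tree_arcs o t ->
  (x, x.+2) \in tree_arcs o t \/ starts (tree_arcs o t) x.+1.
Proof.
have sub s s' z : {subset s <= s'} -> (z, z.+2) \in s \/ starts s z.+1 ->
    (z, z.+2) \in s' \/ starts s' z.+1.
  move=> ss [/ss|/startsP[w /ss zw]]; first by left.
  by right; apply/startsP; exists w.
elim: t o x y => //= l IHl r IHr o x y; rewrite inE mem_cat.
set s := _ :: _.
have ls : {subset tree_arcs o l <= s} by move=> e; rewrite /s inE mem_cat => ->; rewrite orbT.
have rs : {subset tree_arcs (o + nleaves l) r <= s}.
  by move=> e; rewrite /s inE mem_cat => ->; rewrite !orbT.
case/or3P => [/eqP[-> _]|/IHl/(sub _ _ _ ls)|/IHr/(sub _ _ _ rs)] //.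
case: l IHl @s ls rs => [|l1 l2] IHl s ls rs; last first.
  apply: (sub _ _ _ ls); apply: (IHl _ _ (o + nleaves (Caret l1 l2))).
  exact: tree_arcs_full.
case: r IHr @s ls rs => [|r1 r2] _ s ls rs.
  by left; rewrite /s /= addn2 inE eqxx.
right; apply/startsP; exists (o.+1 + nleaves (Caret r1 r2)); apply: rs.
by rewrite /= addn1 inE eqxx.
Qed.

Lemma forest_arc_ear o f x y : (x, y) \in forest_arcs o f ->
  (x, x.+2) \in forest_arcs o f \/ starts (forest_arcs o f) x.+1.
Proof.
elim: f o => //= t f IH o; rewrite mem_cat => /orP[/tree_arc_ear|/IH].
  case=> [xy|xy]; first by left; rewrite mem_cat xy.
  by right; rewrite /starts has_cat -/(starts _ _) xy.
case=> [xy|xy]; first by left; rewrite mem_cat xy orbT.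
by right; rewrite /starts has_cat -!/(starts _ _) xy orbT.
Qed.

Lemma tree_arcs_addn o o' t :
  tree_arcs (o' + o) t = [seq (o' + e.1, o' + e.2) | e <- tree_arcs o t].
Proof.
by elim: t o => //= l IHl r IHr o; rewrite map_cat IHl -IHr !addnA.
Qed.

Lemma forest_arcs_addn o o' f :
  forest_arcs (o' + o) f = [seq (o' + e.1, o' + e.2) | e <- forest_arcs o f].
Proof.
by elim: f o => //= t f IH o; rewrite map_cat tree_arcs_addn -IH addnA.
Qed.

Lemma forest_arcs_cat o f g :
  forest_arcs o (f ++ g) = forest_arcs o f ++ forest_arcs (o + bound f (size f)) g.
Proof.
by elim: f o => [|t f IH] o /=; rewrite ?addn0 // IH catA addnA.
Qed.

Lemma forest_arcs_nseq o k : forest_arcs o (nseq k Leaf) = [::].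
Proof. by elim: k o => //= k IH o; rewrite IH. Qed.

Lemma forest_arcs_head o f :
  forest_arcs o f = tree_arcs o (head Leaf f) ++ forest_arcs (o + bound f 1) (behead f).
Proof. by case: f => //= t f; rewrite addn0. Qed.

Lemma bound_arc o f i : nth Leaf f i <> Leaf ->
  (o + bound f i, o + bound f i.+1) \in forest_arcs o f.
Proof.
elim: i f o => [|i IH] [|t f] o //=; rewrite mem_cat.
  by move=> tL; rewrite !addn0 tree_arcs_full.
by move=> /(IH _ (o + nleaves t)); rewrite -!addnA => ->; rewrite orbT.
Qed.

Lemma bound_exposed o f i : exposed (forest_arcs o f) (o + bound f i).
Proof.
elim: f i o => [|t f IH] [|i] o //; rewrite /exposed /= all_cat.
  apply/andP; split; apply/allP => -[x y].
    by case/tree_arcs_bounds => *; apply/negP => /=; lia.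
  by case/forest_arcs_bounds => *; apply/negP => /=; lia.
apply/andP; split; last by rewrite addnA; apply: IH.
by apply/allP => -[x y] /tree_arcs_bounds[*]; apply/negP => /=; lia.
Qed.

(** The roots of the forest are the only arcs that nothing covers, and they jump
    over all gaps inside their trees. *)
Lemma exposed_bound o f v : o <= v -> exposed (forest_arcs o f) v ->
  exists i, v = o + bound f i.
Proof.
elim: f o => [|t f IH] o ov.
  move=> _; exists (v - o); suff E i : bound [::] i = i by rewrite E subnKC.
  by elim: i => //= i ->.
rewrite /exposed /= all_cat => /andP[et ef].
have [vt|tv] := ltnP v (o + nleaves t); last first.
  by have [i ->] := IH _ tv ef; exists i.+1; rewrite addnA.
case: (ltngtP o v) ov => // [ov _|<- _]; last by exists 0; rewrite addn0.
have tL : t <> Leaf by move=> t0; rewrite t0 /= in vt; lia.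
by have /allP/(_ _ (tree_arcs_full o tL)) := et; rewrite /= ov vt.
Qed.

Lemma bound_leaf_starts o f i : nth Leaf f i = Leaf ->
  starts (forest_arcs o f) (o + bound f i) = false.
Proof.
move=> fi; apply/negP => /startsP[y].
elim: i f o fi => [|i IH] [|t f] o //= fi; rewrite mem_cat => /orP[].
- by rewrite fi.
- by case/forest_arcs_bounds; have := nleaves_gt0 t; lia.
- by case/tree_arcs_bounds; lia.
- by rewrite addnA; apply: IH.
Qed.

Lemma perm_forest_arcs_join o f i :
  perm_eq (forest_arcs o (join i f))
    ((o + bound f i, o + bound f i.+2) :: forest_arcs o f).
Proof.
elim: i f o => [|i IH] f o.
  by case: f => [|a [|b f]] /=; rewrite ?addn0 ?drop0 ?cats0 -?catA ?addnA.
rewrite [join _ _]/= [forest_arcs o (_ :: _)]/= (forest_arcs_head o f).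
rewrite perm_sym ?cat_cons -cat1s perm_catCA perm_sym perm_cat2l.
by rewrite (perm_trans (IH _ _)) // -nleaves_head -!addnA perm_refl.
Qed.

Lemma bound_join_le f i j : j <= i -> bound (join i f) j = bound f j.
Proof. by elim: i f j => [|i IH] f [|j] //= /IH->. Qed.

Lemma bound_join_gt f i j : i < j -> bound (join i f) j = bound f j.+1.
Proof.
elim: i f j => [|i IH] f [|j] //; rewrite ltnS => ij.
  by case: f => [|a [|b f]] /=; rewrite ?drop0 ?addnA.
by rewrite [LHS]/= IH.
Qed.

Lemma join_surj f i : nth Leaf f i <> Leaf -> exists g, f = join i g.
Proof.
elim: i f => [|i IH] [|t f] //=; last by case/IH => g ->; exists (t :: g).
by case: t => // l r _; exists (l :: r :: f); rewrite /= drop0.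
Qed.

Lemma bound_insert_le f i j : j <= i -> bound (insert_leaf i f) j = bound f j.
Proof. by elim: i f j => [|i IH] f [|j] //= /IH->. Qed.

Lemma map_id_arcs q (s : seq (nat * nat)) :
  (forall e, e \in s -> e.1 < e.2 <= q) ->
  [seq (bump q.+1 e.1, bump q.+1 e.2) | e <- s] = s.
Proof.
move=> sq; rewrite -[RHS]map_id; apply/eq_in_map => -[x y] /sq /= xy.
by rewrite /bump; congr pair; lia.
Qed.

Lemma map_shift_arcs q (s : seq (nat * nat)) :
  (forall e, e \in s -> q < e.1 < e.2) ->
  [seq (bump q.+1 e.1, bump q.+1 e.2) | e <- s] = [seq (1 + e.1, 1 + e.2) | e <- s].
Proof.
move=> sq; apply/eq_in_map => -[x y] /sq /= xy.
by rewrite /bump; congr pair; lia.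
Qed.

(** Inserting a leaf after the leaf [bound f i] creates the gap number
    [(bound f i).+1]; the arcs keep their ends, renumbered by [bump]. *)
Lemma forest_arcs_insert o f i : nth Leaf f i = Leaf ->
  forest_arcs o (insert_leaf i f) =
  [seq (bump (o + bound f i).+1 e.1, bump (o + bound f i).+1 e.2) | e <- forest_arcs o f].
Proof.
elim: i f o => [|i IH] f o fi.
  rewrite addn0 /= addn1 map_shift_arcs -?forest_arcs_addn // => -[x y].
  by case: f fi => [|t f] //= ->; case/forest_arcs_bounds => /=; lia.
rewrite [insert_leaf _ _]/= [forest_arcs o (_ :: _)]/= (forest_arcs_head o f) map_cat.
rewrite map_id_arcs => [|[x y] /tree_arcs_bounds[] /=]; last by lia.
have fi' : nth Leaf (behead f) i = Leaf by case: (f) fi => [|? ?] //=; rewrite nth_nil.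
congr (_ ++ _); rewrite nleaves_head IH //.
have -> : bound f i.+1 = bound f 1 + bound (behead f) i by rewrite -[i.+1]add1n boundD drop1.
by rewrite addnA.
Qed.

Lemma nleaves_expand k t : nleaves (tree_expand k t) = (nleaves t).+1.
Proof. by elim: t k => //= l IHl r IHr k; case: ifP => _ /=; rewrite ?IHl ?IHr ?addnS. Qed.

Lemma perm_tree_arcs_expand o t k : k < nleaves t ->
  perm_eq (tree_arcs o (tree_expand k t))
   ((o + k, (o + k).+2)
     :: [seq (bump (o + k).+1 e.1, bump (o + k).+1 e.2) | e <- tree_arcs o t]).
Proof.
elim: t k o => [|l IHl r IHr] k o /=.
  by case: k => // _; rewrite !addn0 addn2.
move=> kt.
have E : forall s t' : seq (nat * nat), forall x y z, perm_eq s (x :: t') -> y = z ->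
   perm_eq (y :: s) (x :: z :: t').
  move=> s t' x y z st ->; rewrite (perm_trans (y := z :: x :: t')) ?perm_cons //.
  by rewrite -cat1s -(cat1s x) perm_catCA.
case: ifP => kl /=; rewrite ?nleaves_expand; apply: E; rewrite ?map_cat -?cat_cons.
- rewrite perm_cat ?IHl // (map_shift_arcs (q := o + k)) => [|[x y]].
    by rewrite -tree_arcs_addn add1n addnS.
  by case/tree_arcs_bounds => /= *; lia.
- by congr pair; rewrite /bump; lia.
- rewrite (map_id_arcs (q := o + k)) => [|[x y] /tree_arcs_bounds[] /=]; last by lia.
  rewrite perm_sym ?cat_cons -cat1s perm_catCA perm_sym perm_cat2l.
  by have := IHr (k - nleaves l) (o + nleaves l); rewrite -!addnA subnKC 1?leqNgt ?kl //; apply; lia.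
- by congr pair; rewrite /bump; lia.
Qed.

Lemma perm_forest_arcs_expand o f k :
  perm_eq (forest_arcs o (forest_expand k f))
   ((o + k, (o + k).+2)
     :: [seq (bump (o + k).+1 e.1, bump (o + k).+1 e.2) | e <- forest_arcs o f]).
Proof.
elim: f k o => [|t f IH] k o /=.
  rewrite -cats1 forest_arcs_cat forest_arcs_nseq size_nseq /= addn2.
  suff -> : bound (nseq k Leaf) k = k by [].
  by elim: k => //= k ->.
case: ifP => kl /=; rewrite ?nleaves_expand ?map_cat -?cat_cons.
  rewrite perm_cat ?perm_tree_arcs_expand // (map_shift_arcs (q := o + k)) => [|[x y]].
    by rewrite -forest_arcs_addn add1n addnS.
  by case/forest_arcs_bounds => /= *; lia.
rewrite (map_id_arcs (q := o + k)) => [|[x y] /tree_arcs_bounds[] /=]; last by lia.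
rewrite perm_sym ?cat_cons -cat1s perm_catCA perm_sym perm_cat2l.
by have := IH (k - nleaves t) (o + nleaves t); rewrite -!addnA subnKC // leqNgt kl.
Qed.

Lemma tree_expand_surj o t k : (o + k, (o + k).+2) \in tree_arcs o t ->
  exists2 t', t = tree_expand k t' & k < nleaves t'.
Proof.
elim: t k o => //= l IHl r IHr k o; rewrite inE mem_cat => /or3P[/eqP[k0 lr]|kl|kr].
- have [l0 r0] := (nleaves_gt0 l, nleaves_gt0 r).
  have [-> ->] : l = Leaf /\ r = Leaf by split; apply: nleaves1; lia.
  by exists Leaf => //=; lia.
- have [l' -> kl'] := IHl _ _ kl; exists (Caret l' r) => /=; first by rewrite kl'.
  exact: ltn_addr.
- move: kr; have [kl|kl] := ltnP k (nleaves l); first by case/tree_arcs_bounds; lia.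
  have E : o + k = o + nleaves l + (k - nleaves l) by lia.
  rewrite E => /IHr[r' -> kr']; exists (Caret l r') => /=; last by lia.
  by rewrite ltnNge kl.
Qed.

Lemma forest_expand_surj o f k : (o + k, (o + k).+2) \in forest_arcs o f ->
  exists g, f = forest_expand k g.
Proof.
elim: f k o => //= t f IH k o; rewrite mem_cat => /orP[/tree_expand_surj[t' -> kt']|kf].
  by exists (t' :: f) => /=; rewrite kt'.
have [kt|kt] := ltnP k (nleaves t); first by case/forest_arcs_bounds: kf; lia.
have E : o + k = o + nleaves t + (k - nleaves t) by lia.
move: kf; rewrite E => /IH[g ->]; exists (t :: g) => /=.
by rewrite ltnNge kt.
Qed.

Arguments bound : simpl never.

(** * How the moves change the weight *)

Definition well_formed (a : seq (nat * nat)) : Prop :=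
  forall x y, (x, y) \in a -> x < y.

Lemma forest_arcs_wf o f : well_formed (forest_arcs o f).
Proof. by move=> x y /forest_arcs_bounds[]; lia. Qed.

Lemma adj_lt a b x y : well_formed a -> well_formed b -> adj a b x y -> x < y.
Proof. by move=> wa wb /orP[] /orP[/eqP->|]//; [apply: wa | apply: wb]. Qed.

Lemma parent_lt a b par : well_formed a -> well_formed b ->
  parent_map a b par -> forall y, 0 < y -> par y < y.
Proof. by move=> wa wb [_ pm] y /pm/adj_lt-> . Qed.

Lemma adj_sub a b a' b' x y : {subset a <= a'} -> {subset b <= b'} ->
  adj a b x y -> adj a' b' x y.
Proof.
by move=> sa sb /orP[] /orP[e|e]; rewrite /adj /edge ?e ?(sa _ e) ?(sb _ e) ?orbT.
Qed.

Lemma bound_edge f j : edge (forest_arcs 0 f) (bound f j) (bound f j.+1).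
Proof.
rewrite /edge boundS; case E : (nth Leaf f j) => [|l r]; first by rewrite addn1 eqxx.
have /(bound_arc 0) : nth Leaf f j <> Leaf by rewrite E.
by rewrite !add0n boundS E => ->; rewrite orbT.
Qed.

Lemma bound_exposed0 f j : exposed (forest_arcs 0 f) (bound f j).
Proof. exact: (bound_exposed 0). Qed.

Lemma exposed_bound0 f v : exposed (forest_arcs 0 f) v -> exists j, v = bound f j.
Proof. exact: exposed_bound. Qed.

Lemma penalty_gt0 a b p : penalty a b p -> 0 < p.
Proof. by case/andP. Qed.

Lemma penaltyP a b p : 0 < p -> starts a p || starts b p \/
   [/\ exposed a p, exposed b p & exists2 z, p < z & starts a z || starts b z] ->
  penalty a b p.
Proof.
rewrite /penalty => -> [/orP[]->|[-> -> [z pz]]]; rewrite ?orbT // => /orP[]/startsP[w zw];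
  apply/or3P/Or33/hasP; by exists (z, w); rewrite // mem_cat zw ?orbT.
Qed.

Lemma penalty_cases a b p : penalty a b p -> starts a p || starts b p \/
   [/\ exposed a p, exposed b p & exists2 z, p < z & starts a z || starts b z].
Proof.
case/andP => _ /or3P[->|->|/and3P[ea eb /hasP[[z w] /=]]]; rewrite ?orbT; [by left|by left|].
move=> zw pz; right; split=> //; exists z => //; rewrite mem_cat in zw.
by case/orP: zw => zw; apply/orP; [left | right]; apply/startsP; exists w.
Qed.

Lemma starts_cons a x y z : starts ((x, y) :: a) z = (x == z) || starts a z.
Proof. by []. Qed.

Lemma exposed_cons a x y v :
  exposed ((x, y) :: a) v = ~~ (x < v < y) && exposed a v.
Proof. by []. Qed.

Lemma pair_weight_le_eqi n a b a' b' k : a =i a' -> b =i b' ->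
  pair_weight_le n a b k -> pair_weight_le n a' b' k.
Proof.
move=> ea eb [par [par0 pm] w]; exists par.
  split=> // y /pm; apply: adj_sub => e; by rewrite ?ea ?eb.
apply: weight_le_sub w => // w [[p pp rp] nz]; split=> //; exists p => //.
move: pp; rewrite /penalty /starts /exposed !has_cat.
by rewrite !(eq_has_r ea) !(eq_has_r eb) (eq_all_r ea) (eq_all_r eb).
Qed.

(** All new penalty vertices are among the exposed vertices [bound A 1], ...,
    [bound A i], which are consecutive neighbours: [add_path] applies. *)
Lemma weight_le_join n A b i k : i <= n ->
  pair_weight_le n (forest_arcs 0 A) b k ->
  pair_weight_le n ((bound A i, bound A i.+2) :: forest_arcs 0 A) b k.
Proof.
set a := forest_arcs 0 A => le_in [par [par0 pm] wp].
have [par' par'E hP] := add_path (penalty a b) le_in par0 (erefl : bound A 0 = 0) (@bound_inj A).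
have sub : {subset a <= (bound A i, bound A i.+2) :: a} by move=> e; rewrite inE orbC => ->.
exists par'.
  split=> [|y y0].
    by case: (par'E 0) => [-> //|[j _ [/esym]]]; have := bound_lt A (ltn0Sn j); lia.
  case: (par'E y) => [->|[j _ [-> ->]]]; first by apply: adj_sub (pm _ y0).
  by apply: (@adj_sub a b) => //; rewrite /adj bound_edge.
apply: weight_le_sub wp => // w [[p pp rp] nz]; apply: hP; split=> //; exists p => //.
have p0 := penalty_gt0 pp; have boundpos j : p = bound A j -> 0 < j by case: j p0 => //= + e; rewrite e.
case/penalty_cases: pp.
  rewrite starts_cons -orbA => /orP[/eqP ip|st]; last by left; apply: penaltyP p0 _; left.
  by right; exists i; rewrite ?leqnn ?andbT //; apply: boundpos.
rewrite exposed_cons => -[/andP[_ ea] eb [z pz]]; rewrite starts_cons -orbA.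
case/orP => [/eqP zi|st]; last by left; apply: penaltyP p0 _; right; split=> //; exists z.
right; have [j pj] := exposed_bound0 ea; exists j => //; rewrite boundpos //=.
by rewrite leqNgt -(bound_ltE A) -pj; lia.
Qed.

(** Only the vertex under the removed arc can become a penalty vertex, and only
    the removed arc itself is lost to the parent map.  Weaving the path to
    [bound A i] first makes sure that the lower end of that arc is a vertex. *)
Lemma weight_le_split n A B i k : i <= n ->
  pair_weight_le n ((bound A i, bound A i.+2) :: forest_arcs 0 A) (forest_arcs 0 B) k ->
  pair_weight_le n (forest_arcs 0 A) (forest_arcs 0 B) k.+1.
Proof.
set a := forest_arcs 0 A; set b := forest_arcs 0 B => le_in [par0' [par00 pm0] wp0].
set a' := _ :: a in pm0 wp0.
have r01 := bound_lt A (ltnSn i); have r12 := bound_lt A (ltnSn i.+1).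
have wa' : well_formed a'.
  move=> x y; rewrite inE => /orP[/eqP[-> ->]|]; first by lia.
  exact: forest_arcs_wf.
have [par parE hP] := add_path (penalty a' b) le_in par00 (erefl : bound A 0 = 0) (@bound_inj A).
set pen1 := fun p => _ in hP.
have sub : {subset a <= a'} by move=> e; rewrite inE orbC => ->.
have pm : parent_map a' b par.
  split=> [|y y0].
    by case: (parE 0) => [-> //|[j _ [/esym]]]; have := bound_lt A (ltn0Sn j); lia.
  case: (parE y) => [->|[j _ [-> ->]]]; first exact: pm0.
  by apply: (@adj_sub a b) => //; rewrite /adj bound_edge.
have par_lt := parent_lt wa' (@forest_arcs_wf 0 B) pm.
have [M penM] : exists M, forall p, pen1 p -> p <= M.
  have [M penM] := penalty_bounded a' b; exists (maxn M (bound A i)).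
  move=> p [/penM|[j /andP[_]]]; first by rewrite leq_max => ->.
  rewrite leq_eqVlt => /orP[/eqP->|/(bound_lt A) ji] ->; rewrite leq_max ?leqnn ?orbT //.
  by rewrite (ltnW ji) orbT.
have uV : bound A i = 0 \/ height_ge pen1 par (bound A i) 0.
  case: (posnP i) => [->|i0]; first by left.
  by right; apply: height_ge_penalty; right; exists i => //; rewrite i0 leqnn.
have uvx : bound A i < bound A i.+1 < bound A i.+2 by rewrite r01.
have [par' par'E [z hz]] := subdivide n pm.1 par_lt penM uvx uV.
exists par'.
  split=> [|y y0].
    by case: (par'E 0) => [[-> _]|[/esym]|[/esym]]; rewrite ?pm.1; lia.
  case: (par'E y) => [[-> ne]|[-> ->]|[-> ->]]; rewrite /adj ?bound_edge //.
  case/orP: (pm.2 y y0) => [|->]; last by rewrite orbT.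
  rewrite /edge inE => /or3P[->//|/eqP[pu yx]|->]; last by rewrite !orbT.
  by case: ne; rewrite yx -pu -yx.
case: wp0 => s sk sP; exists (z :: s) => // w [[p pp rp] nz].
rewrite inE; case: (hz w) => [|hw|->]; rewrite ?eqxx //; last by rewrite (sP _ (hP _ hw)) orbT.
split=> //; exists p => //; have p0 := penalty_gt0 pp; case/penalty_cases: pp.
  move=> st; left; left; apply: penaltyP p0 _; left; rewrite starts_cons -orbA st; exact: orbT.
case=> ea eb [t pt st].
have [->|/eqP pv] := eqVneq p (bound A i.+1); first by right.
left; left; apply: penaltyP p0 _; right; split=> //; last first.
  by exists t => //; rewrite starts_cons -orbA st orbT.
rewrite exposed_cons ea andbT; apply/negP => /andP[up px]; apply: pv.
have [j pj] := exposed_bound0 ea; rewrite pj !bound_ltE in up px *.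
by congr bound; lia.
Qed.

Lemma bump_inj h : injective (bump h).
Proof. exact: can_inj (@bumpK h). Qed.

Section Bumps.
Variables (q : nat).
Local Notation up := (bump q.+1).
Definition bump_arcs (s : seq (nat * nat)) := [seq (up e.1, up e.2) | e <- s].

Lemma bump_lt x y : (up x < up y) = (x < y).
Proof. by rewrite /bump; lia. Qed.

Lemma bump_surj x : x <> q.+1 -> exists y, x = up y.
Proof. by move=> xq; exists (unbump q.+1 x); rewrite /bump /unbump; lia. Qed.

Lemma mem_bump_arcs s x y : ((up x, up y) \in bump_arcs s) = ((x, y) \in s).
Proof.
apply/mapP/idP => [[[x' y'] xy /= [ex ey]]|xy]; last by exists (x, y).
by rewrite (@bump_inj _ _ _ ex) (@bump_inj _ _ _ ey).
Qed.

Lemma bump_arcsP s x y :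
  (x, y) \in bump_arcs s -> exists x' y', [/\ x = up x', y = up y' & (x', y') \in s].
Proof. by case/mapP => -[x' y'] xy [-> ->]; exists x', y'. Qed.

Lemma starts_bump s x : starts (bump_arcs s) (up x) = starts s x.
Proof.
apply/startsP/startsP => [[y]|[y xy]]; last by exists (up y); rewrite mem_bump_arcs.
by case/bump_arcsP => x' [y' [/bump_inj-> _ xy]]; exists y'.
Qed.

Lemma starts_bump_inv s x : starts (bump_arcs s) x -> exists2 y, x = up y & starts s y.
Proof.
case/startsP => y /bump_arcsP[x' [y' [-> _ xy]]]; exists x' => //.
by apply/startsP; exists y'.
Qed.

Lemma exposed_bump s v : exposed (bump_arcs s) (up v) = exposed s v.
Proof.
by rewrite /exposed all_map; apply: eq_all => -[x y] /=; rewrite !bump_lt.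
Qed.

(** The gap [q.+1] has no neighbours except [q] and [q.+2], so [q] is its parent
    and contracting this edge keeps all other adjacencies. *)
Lemma weight_le_contract_arcs n a b k :
  pair_weight_le n (bump_arcs a) ((q, q.+2) :: bump_arcs b) k ->
  pair_weight_le n a b k.
Proof.
set a' := bump_arcs a; set b' := _ :: _ => -[par [par0 pm] wp].
have parq : par q.+1 = q.
  case/orP: (pm q.+1 isT) => /orP[/eqP[]//|].
    by case/bump_arcsP => x [y [_ /eqP]]; rewrite /bump; lia.
  rewrite inE => /orP[/eqP[_]|]; first by lia.
  by case/bump_arcsP => x [y [_ /eqP]]; rewrite /bump; lia.
exists (fun y => unbump q (par (up y))).
  split=> [|y y0]; first by rewrite (_ : up 0 = 0) ?par0.
  have uy0 : 0 < up y by rewrite /bump; lia.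
  have [z ez] : exists z, z = par (up y) by exists (par (up y)).
  have := pm _ uy0; rewrite -ez /adj /edge.
  have triv : y = (unbump q z).+1 -> adj a b (unbump q z) y.
    by move=> e; rewrite [X in adj _ _ _ X]e /adj /edge eqxx.
  have upK x : unbump q (up x) = x by rewrite /bump /unbump; lia.
  case/orP => /orP[/eqP e|].
  - by apply: triv; move: e; rewrite /bump /unbump; lia.
  - by case/bump_arcsP => x' [y' [-> /bump_inj-> xy]]; rewrite upK xy orbT.
  - by apply: triv; move: e; rewrite /bump /unbump; lia.
  - rewrite inE => /orP[/eqP[-> e]|]; last first.
      by case/bump_arcsP => x' [y' [-> /bump_inj-> xy]]; rewrite upK xy !orbT.
    by have -> : y = q.+1; [move: e; rewrite /bump; lia | rewrite /unbump ltnn subn0 eqxx].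
apply: weight_le_contract parq _ wp => p pp; have p0 := penalty_gt0 pp.
apply: penaltyP; first by rewrite /bump; lia.
case/penalty_cases: pp => [st|[ea eb [z pz st]]].
  by left; rewrite starts_cons !starts_bump; case/orP: st => ->; rewrite ?orbT.
right; split; first by rewrite exposed_bump.
  by rewrite exposed_cons exposed_bump eb andbT /bump; lia.
exists (up z); first by rewrite bump_lt.
by rewrite starts_cons !starts_bump; case/orP: st => ->; rewrite ?orbT.
Qed.
End Bumps.

(** Since the new arc [(q, q.+2)] takes over from the edge between [q] and its
    right neighbour, the old parent map survives the renumbering.  The new penalty
    vertices are exposed in [A] and not beyond [q], so [add_path] absorbs them. *)
Lemma weight_le_expand_arcs n A b i k : i <= n -> nth Leaf A i = Leaf ->
  let q := bound A i in
  pair_weight_le n (forest_arcs 0 A) b k ->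
  pair_weight_le n (bump_arcs q (forest_arcs 0 A)) ((q, q.+2) :: bump_arcs q b) k.
Proof.
move=> le_in Ai q; set a := forest_arcs 0 A => -[par [par0 pm] wp].
have ins : forest_arcs 0 (insert_leaf i A) = bump_arcs q a by apply: forest_arcs_insert.
have insr j : j <= i -> bound (insert_leaf i A) j = bound A j by apply: bound_insert_le.
set a' := bump_arcs q a; set b' := _ :: _.
pose par1 := par_expand q par.
have upS y : adj a' b' (bump q.+1 y) (bump q.+1 y.+1).
  have [->|/eqP yq] := eqVneq y q; last by rewrite /adj /edge /bump; lia.
  by rewrite /adj /edge [b']lock; have -> : (bump q.+1 q, bump q.+1 q.+1) = (q, q.+2);
     [rewrite /bump; congr pair; lia | rewrite -lock inE eqxx !orbT].
have pm1 : parent_map a' b' par1.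
  split=> [|y y0]; first by rewrite /par1 /par_expand (_ : unbump q.+1 0 = 0) ?par0.
  rewrite /par1 /par_expand; case: eqVneq => [->|/eqP/bump_surj[y' ey]].
    by rewrite /adj /edge eqxx.
  have y'0 : 0 < y' by move: y0; rewrite ey /bump; lia.
  rewrite ey bumpK; have [|e] := eqVneq y' (par y').+1.
    by move=> e; rewrite [X in adj _ _ _ (bump _ X)]e; apply: upS.
  case/orP: (pm _ y'0) => /orP[/eqP e'|xy]; rewrite -?e' ?eqxx // in e.
    by rewrite /adj /edge mem_bump_arcs xy orbT.
  by apply/orP; right; apply/orP; right; rewrite inE mem_bump_arcs xy orbT.
have wp1 := weight_le_expand q wp.
set pen1 := fun p => exists2 p', _ & _ in wp1.
have [par' par'E hP] := add_path pen1 le_in pm1.1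
   (erefl : bound (insert_leaf i A) 0 = 0) (@bound_inj (insert_leaf i A)).
exists par'.
  split=> [|y y0].
    case: (par'E 0) => [-> |[j _ [/esym]]]; first exact: pm1.1.
    by have := bound_lt (insert_leaf i A) (ltn0Sn j); lia.
  case: (par'E y) => [->|[j _ [-> ->]]]; first exact: pm1.2.
  by rewrite /adj /a' -ins bound_edge.
apply: weight_le_sub wp1 => // w [[p pp rp] nz]; apply: hP; split=> //; exists p => //.
have p0 := penalty_gt0 pp.
have old p' : p = bump q.+1 p' -> penalty a b p' -> pen1 p by exists p'.
have pos p' : p = bump q.+1 p' -> 0 < p' by move: p0 => + e; rewrite e /bump; lia.
case/penalty_cases: pp => [|[ea]].
  rewrite starts_cons orbCA => /orP[/eqP qp|st].
    right; exists i; last by rewrite insr.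
    by rewrite leqnn andbT lt0n; apply/eqP => i0; rewrite -qp /q i0 bound0 in p0.
  have [p' pp' st'] : exists2 p', p = bump q.+1 p' & starts a p' || starts b p'.
    by case/orP: st => /starts_bump_inv[y -> st]; exists y; rewrite // st ?orbT.
  by left; apply: (old _ pp'); apply: penaltyP (pos _ pp') _; left.
rewrite exposed_cons => /andP[pq eb] [z pz st].
have [p' pp'] : exists y, p = bump q.+1 y by apply: bump_surj; lia.
rewrite pp' !exposed_bump in ea eb.
move: st; rewrite starts_cons orbCA => /orP[/eqP qz|st].
  have pp : p = p' by move: pz; rewrite -qz pp' /bump; lia.
  have [j pj] := exposed_bound0 ea; right; exists j.
    apply/andP; split.
      by rewrite lt0n; apply/eqP => j0; rewrite pp pj j0 bound0 in p0.
    by rewrite leqNgt -(bound_ltE A) -/q -pj; lia.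
  rewrite insr; first by rewrite pp.
  by rewrite leqNgt -(bound_ltE A) -/q -pj; lia.
left; apply: (old _ pp'); apply: penaltyP (pos _ pp') _; right; split=> //.
by case/orP: st => /starts_bump_inv[y ey st]; exists y; rewrite ?st ?orbT //;
  rewrite -(bump_lt q) -ey -pp'.
Qed.

(** * A move that lowers the length *)

(** The path from [z] to the root has to pass from above [l] to [l] or below. *)
Lemma path_crosses (V : nat -> Prop) par l z :
    par 0 = 0 -> (forall y, 0 < y -> par y < y) ->
    (forall y, V y -> V (par y)) -> V z -> l < z ->
  exists2 y, V y & par y <= l < y.
Proof.
move=> par0 par_lt Vpar; elim/ltn_ind: z => z IH Vz lz.
have [pl|lp] := leqP (par z) l; first by exists z; rewrite ?pl.
by apply: IH lp; [apply: par_lt; lia | apply: Vpar].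
Qed.

(** The three outcomes are the three kinds of shortening moves: a join at the root
    that turns the heavy vertex [bound A 2] into a child of the root, the
    removal of an arc that the penalty tree does not use, and a cancellation. *)
Lemma weight_descent n A B k : 0 < n ->
    forest_arcs 0 A ++ forest_arcs 0 B <> [::] ->
    pair_weight_le n (forest_arcs 0 A) (forest_arcs 0 B) k ->
  [\/ exists2 k', k' < k &
        pair_weight_le n ((bound A 0, bound A 2) :: forest_arcs 0 A) (forest_arcs 0 B) k',
      exists2 i, i <= n & exists2 A', A = join i A' &
        pair_weight_le n (forest_arcs 0 A') (forest_arcs 0 B) k
    | exists2 i, i <= n & [/\ nth Leaf A i = Leaf, nth Leaf A i.+1 = Leaf &
        (bound A i, (bound A i).+2) \in forest_arcs 0 B]].
Proof.
set a := forest_arcs 0 A; set b := forest_arcs 0 B => n0 ab [par pm [s sk sP]].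
have par_lt := parent_lt (@forest_arcs_wf 0 A) (@forest_arcs_wf 0 B) pm.
have [par0 pmE] := pm.
pose V y := height_ge (penalty a b) par y 0.
have penV y : penalty a b y -> V y by apply: height_ge_penalty.
have Vpar y : V y -> V (par y) by move=> /height_ge_step/(height_ge_le (leq0n _)).
pose tree_edge j := V (bound A j.+1) /\ par (bound A j.+1) = bound A j.
(* The tree edges tree_edge 0, ..., tree_edge n form the path from 0 to bound A n.+1. *)
have [all_edges|] := pselect (forall j, j <= n -> tree_edge j).
  apply: Or31; pose r2 := bound A 2.
  have r1 : par r2 = bound A 1 by case: (all_edges 1).
  have r1_gt0 : 0 < bound A 1 by rewrite -(bound0 A) bound_lt.
  have itr m : m <= n.+1 -> iter m par (bound A n.+1) = bound A (n.+1 - m).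
    elim: m => [|m IH] mn /=; first by rewrite subn0.
    rewrite IH; last exact: ltnW.
    have -> : n.+1 - m = (n - m).+1 by lia.
    by rewrite (all_edges (n - m) (leq_subr _ _)).2 subSS.
  have r2s : r2 \in s.
    apply: sP; split; last by rewrite r1; lia.
    have -> : r2 = iter n.-1 par (bound A n.+1) by rewrite itr; [congr bound|]; lia.
    by rewrite -[X in height_ge _ _ _ X]addn0; apply: height_ge_iter; case: (all_edges n).
  exists (size [seq w <- s | w != r2]).
    apply: leq_trans sk; rewrite size_filter -(count_predC (predC1 r2) s) -addn1 leq_add2l.
    by rewrite -has_count; apply/hasP; exists r2 => //=; rewrite eqxx.
  pose par' y := if y == r2 then 0 else par y.
  have par'0 : par' 0 = 0 by rewrite /par'; case: ifP.
  exists par'.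
    split=> // y y0; rewrite /par'; case: eqP => [->|_].
      by rewrite /adj /edge inE -(bound0 A) eqxx !orbT.
    by apply: adj_sub (pmE _ y0) => // e; rewrite inE orbC => ->.
  exists [seq w <- s | w != r2] => // w [[p pp [m nm mw]] nz].
  have wr2 : w != r2 by apply/eqP => wr; apply: nz; rewrite /par' wr eqxx.
  have par'w : par' w = par w by rewrite /par' (negPf wr2).
  rewrite mem_filter wr2 /=; apply: sP; split; last by rewrite -par'w.
  exists p.
    have p0 := penalty_gt0 pp; apply: (penaltyP p0); case/penalty_cases: pp => [|[+ eb [z pz]]].
      by rewrite starts_cons -orbA => /orP[/eqP p1|st]; [rewrite -p1 bound0 in p0 | left].
    rewrite exposed_cons starts_cons -orbA => /andP[_ ea] /orP[/eqP z1|st].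
      by rewrite -z1 bound0 in pz.
    by right; split=> //; exists z.
  exists m => //; rewrite -mw; elim: m {nm} w mw nz {wr2 par'w} => //= m IH w mw nz.
  case: (eqVneq (iter m par' p) r2) => [e|ne].
    by case: nz; rewrite -mw e {2}/par' eqxx par'0.
  rewrite {1}/par' (negPf ne) (IH _ erefl) // => par'w0.
  by apply: nz; rewrite -mw par'w0.
move=> some_missing.
have [i [i_n before not_edge]] : exists i, [/\ i <= n, forall j, j < i -> tree_edge j & ~ tree_edge i].
  have ex : exists i, (i <= n) && ~~ `[< tree_edge i >].
    apply: contrapT => none; apply: some_missing => j jn; apply: contrapT => nj.
    by apply: none; exists j; rewrite jn; apply/asboolPn.
  exists (ex_minn ex); case: ex_minnP => i /andP[i_n /asboolPn ne] min; split=> // j ji.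
  apply: contrapT => /asboolPn nj; have := min j; rewrite nj (leq_trans (ltnW ji)) //.
  by move=> /(_ isT); rewrite leqNgt ji.
have stV z : 0 < z -> starts a z || starts b z -> V z.
  by move=> z0 st; apply/penV/(penaltyP z0); left.
case Ai : (nth Leaf A i) => [|t1 t2]; last first.
  apply: Or32; exists i => //.
  have [A' eA] : exists A', A = join i A' by apply: join_surj; rewrite Ai.
  exists A' => //; set a' := forest_arcs 0 A'.
  pose u := bound A' i; pose v := bound A' i.+1; pose x := bound A' i.+2.
  have aE : a =i (u, x) :: a'.
    by move=> e; rewrite /a eA (perm_mem (perm_forest_arcs_join _ _ _)).
  have [uE xE] : bound A i = u /\ bound A i.+1 = x.
    by rewrite eA bound_join_le // bound_join_gt.
  have par_x y : V y -> y = x -> par x <> u.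
    by move=> Vy yx pxu; apply: not_edge; rewrite /tree_edge uE xE -{1}yx.
  pose par' y := if (y == x) && (par x == u) then v else par y.
  have uv : u < v by apply: bound_lt.
  have vx : v < x by apply: bound_lt.
  have par'V y : V y -> par' y = par y.
    move=> Vy; rewrite /par'; case: eqP => //= yx; case: eqP => // pxu.
    by case: (par_x _ Vy yx).
  exists par'.
    split=> [|y y0]; first by rewrite /par'; case: eqP => //=; lia.
    rewrite /par'; case: (boolP ((y == x) && _)) => [/andP[/eqP-> _]|ne].
      by rewrite /adj bound_edge.
    case/orP: (pmE y y0) => [|e]; last by rewrite /adj e orbT.
    rewrite /edge aE inE xpair_eqE => /or3P[e|/andP[/eqP pu /eqP yx]|e].
    - by rewrite /adj /edge e.
    - by move: ne; rewrite -yx pu !eqxx.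
    - by rewrite /adj /edge e orbT.
  have penalty'V p : penalty a' b p -> V p.
    move=> pp; have p0 := penalty_gt0 pp.
    have sta z : starts a' z || starts b z -> starts a z || starts b z.
      case/orP => [/startsP[w zw]|->]; last by rewrite orbT.
      by apply/orP; left; apply/startsP; exists w; rewrite aE inE zw orbT.
    case/penalty_cases: pp => [/sta|[ea eb [z pz /sta st]]]; first exact: stV.
    have Vz : V z by apply: stV st; lia.
    have [|/exposedP ea'] := boolP (exposed a p).
      by move=> ea'; apply/penV/(penaltyP p0); right; split=> //; exists z.
    (* Only the removed arc from u to x jumped over p, so p is the gap v below it. *)
    have pv : p = v.
      have [pux|npux] := boolP (u < p < x).
        have [j pj] := exposed_bound0 ea; rewrite pj !bound_ltE in pux *.
        by congr bound; lia.
      case: ea' => c d; rewrite aE inE xpair_eqE => /orP[/andP[/eqP-> /eqP->]|]; first by lia.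
      by move/exposedP: ea; apply.
    (* Nothing jumps over v any more, so the path of a later penalty vertex passes through v. *)
    have [|y Vy /andP[py yp]] := @path_crosses V par p.-1 z par0 par_lt Vpar Vz; first by lia.
    have [<-//|/eqP ny] := eqVneq y p.
    have : adj a b (par y) y by apply: pmE; lia.
    case/orP => /orP[/eqP|]; [lia| |lia|].
      rewrite aE inE xpair_eqE => /orP[/andP[/eqP pu /eqP yx]|ya].
        by case: (par_x _ Vy yx); rewrite -yx.
      by have /exposedP := ea => /(_ _ _ ya) H; exfalso; apply: H; lia.
    by move=> yb; have /exposedP := eb => /(_ _ _ yb) H; exfalso; apply: H; lia.
  exists s => // w [[p /penalty'V Vp [m nm mw]] nz].
  have itE j : iter j par' p = iter j par p /\ V (iter j par p).
    by elim: j => //= j [-> Vj]; rewrite par'V //; split=> //; apply: Vpar.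
  have [mw' Vw] := itE m; rewrite mw' in mw; rewrite -mw in nz *.
  apply: sP; split; last by rewrite -par'V.
  by apply: height_ge_le nm _; rewrite -[X in height_ge _ _ _ X]addn0; apply: height_ge_iter.
apply: Or33; exists i => //; set l := bound A i.
have lS : bound A i.+1 = l.+1 by rewrite boundS Ai addn1.
have ea : exposed a l by apply: bound_exposed0.
have sta : starts a l = false by have := bound_leaf_starts 0 Ai; rewrite add0n.
have [stb|nstb] := boolP (starts b l).
  have [z lz] := startsP _ _ stb.
  (* Vertex l.+1 is enclosed between l and z in B, and l is exposed in A,
     so only l can be its parent. *)
  have nV : ~ V l.+1.
    move=> Vl; have npar : par l.+1 <> l by move=> e; apply: not_edge; rewrite /tree_edge lS.
    case/orP: (pmE l.+1 isT) => /orP[/eqP/eq_add_S/esym //|e].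
      have [_ ?] := forest_arcs_bounds e.
      by have /exposedP := ea => /(_ _ _ e) H; apply: H; lia.
    have [_ ?] := forest_arcs_bounds e; have [_ ?] := forest_arcs_bounds lz.
    by have := forest_arcs_noncrossing e lz; lia.
  have nst : ~~ (starts a l.+1 || starts b l.+1) by apply/negP => st; apply: nV; apply: stV.
  split=> //; last by case: (forest_arc_ear lz) nst => // ->; rewrite orbT.
  apply: contrapT => /(bound_arc 0); rewrite !add0n lS => e.
  by case/orP: nst; left; apply/startsP; eexists; apply: e.
exfalso.
(* If no arc starts at l, the only possible child of l is l.+1. *)
have no_child y : V y -> par y = l -> l < y -> False.
  move=> Vy py ly; have : adj a b l y by rewrite -py; apply: pmE; lia.
  case/orP => /orP[/eqP e|e].
  - by apply: not_edge; rewrite /tree_edge lS -e.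
  - by move/startsP: sta; apply; exists y.
  - by apply: not_edge; rewrite /tree_edge lS -e.
  - by move/startsP: nstb; apply; exists y.
(* Then no path can come from beyond l, since nothing jumps over l. *)
have blocked z : exposed b l -> l < z -> starts a z || starts b z -> False.
  move=> eb lz st; have Vz : V z by apply: stV st; lia.
  have [y Vy /andP[pyl ly]] := @path_crosses V par l z par0 par_lt Vpar Vz lz.
  move: pyl; rewrite leq_eqVlt => /orP[/eqP py|py]; first exact: no_child Vy py ly.
  have : adj a b (par y) y by apply: pmE; lia.
  case/orP => /orP[/eqP|e]; [lia| |lia|].
    by have /exposedP := ea => /(_ _ _ e) H; apply: H.
  by have /exposedP := eb => /(_ _ _ e) H; apply: H.
case: (posnP i) => [i0|i0].
  have l0 : l = 0 by rewrite /l i0.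
  case E : (a ++ b) ab => [//|[z w] s'] _.
  have : (z, w) \in a ++ b by rewrite E inE eqxx.
  rewrite mem_cat => zw; have st : starts a z || starts b z.
    by case/orP: zw => zw; apply/orP; [left|right]; apply/startsP; exists w.
  apply: (blocked z) => //; first by apply/exposedP => ? ? _; rewrite l0.
  rewrite l0 lt0n; apply/eqP => z0; move: st.
  by rewrite z0 -l0 sta (negPf nstb).
have [p pp [[|m] _ pl]] : V l.
  by have [] := before i.-1; rewrite ?prednK ?leqnn.
  rewrite /= in pl; rewrite pl in pp.
  case/penalty_cases: pp => [|[_ eb [z lz st]]]; first by rewrite sta (negPf nstb).
  exact: blocked eb lz st.
apply: (no_child (iter m par p)) => //; first by exists p => //; exists m.
rewrite -pl /=; apply: par_lt; rewrite lt0n; apply/eqP => e.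
have : 0 < l by rewrite -(bound0 A) bound_lt.
by rewrite -pl /= e par0.
Qed.

(** * Elements of F represented by pairs of forests *)

Local Open Scope group_scope.

Fixpoint tree_elt o (t : tree) : ThompsonF :=
  if t is Caret l r then
    xgen o * tree_elt o l * tree_elt (o + nleaves l)%N r
  else 1.

Fixpoint forest_elt o (f : seq tree) : ThompsonF :=
  if f is t :: f' then tree_elt o t * forest_elt (o + nleaves t)%N f' else 1.

Lemma xgen_swap i j : i < j -> xgen j * xgen i = xgen i * xgen j.+1.
Proof. by move=> ij; rewrite -(xgen_rel ij) !mulgA mulgV mul1g. Qed.

(** Passing [xgen i] through one letter with a smaller index raises the index by
    one, and the tree contributes one letter for each of its carets. *)
Lemma xgen_tree_elt o t i : o < i ->
  xgen i * tree_elt o t = tree_elt o t * xgen (i + (nleaves t).-1)%N.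
Proof.
elim: t o i => [|l IHl r IHr] o i oi /=; first by rewrite addn0 mulg1 mul1g.
have [l0 r0] := (nleaves_gt0 l, nleaves_gt0 r).
rewrite !mulgA xgen_swap // -!mulgA; congr (_ * _).
rewrite !mulgA IHl; last by lia.
rewrite -!mulgA; congr (_ * _); rewrite IHr; last by lia.
by congr (_ * xgen _); lia.
Qed.

(** By [xgen_tree_elt] the index of the new letter grows on its way to the tree [i]
    from [o + i] to the first leaf of that tree. *)
Lemma forest_elt_join o f i : forest_elt o (join i f) = xgen (o + i)%N * forest_elt o f.
Proof.
elim: i f o => [|i IH] f o; rewrite ?addn0.
  by case: f => [|a [|b f]] /=; rewrite ?drop0 ?mulg1 ?addn0 ?addnA ?mulgA.
have -> : forest_elt o f =
   tree_elt o (head Leaf f) * forest_elt (o + nleaves (head Leaf f))%N (behead f).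
  by case: f => //=; rewrite mulg1.
rewrite mulgA xgen_tree_elt /= ?IH ?mulgA; last by lia.
by congr (_ * xgen _ * _); have := nleaves_gt0 (head Leaf f); lia.
Qed.

Lemma tree_elt_xgen o t k : k < o ->
  tree_elt o t * xgen k = xgen k * tree_elt o.+1 t.
Proof.
elim: t o => [|l IHl r IHr] o ko /=; first by rewrite mulg1 mul1g.
rewrite -!mulgA IHr; last by lia.
by rewrite (mulgA (tree_elt o l)) IHl // !mulgA xgen_swap.
Qed.

Lemma forest_elt_xgen o f k : k < o ->
  forest_elt o f * xgen k = xgen k * forest_elt o.+1 f.
Proof.
elim: f o => [|t f IH] o ko /=; first by rewrite mulg1 mul1g.
by rewrite -mulgA IH ?mulgA ?tree_elt_xgen //; lia.
Qed.

Lemma tree_elt_expand o t k : k < nleaves t ->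
  tree_elt o (tree_expand k t) = tree_elt o t * xgen (o + k)%N.
Proof.
elim: t o k => [|l IHl r IHr] o k /=.
  by case: k => // _; rewrite addn0 !mulg1 mul1g.
move=> kt; case: ifP => kl /=.
  rewrite nleaves_expand IHl // -!mulgA; congr (_ * (_ * _)).
  by rewrite addnS -tree_elt_xgen //; lia.
rewrite IHr ?mulgA; last by lia.
by congr (_ * xgen _); lia.
Qed.

Lemma forest_elt_expand o f k :
  forest_elt o (forest_expand k f) = forest_elt o f * xgen (o + k)%N.
Proof.
elim: f o k => [|t f IH] o k /=.
  rewrite mul1g; elim: k o => [|k IH] o /=; rewrite ?mulg1 ?addn0 //.
  by rewrite mul1g IH addnAC -addnA addn1 addnS.
case: ifP => kl /=; last by rewrite IH mulgA; congr (_ * xgen _); lia.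
rewrite tree_elt_expand // nleaves_expand -!mulgA; congr (_ * _).
by rewrite addnS -forest_elt_xgen //; lia.
Qed.

Lemma forest_elt_insert o f i : nth Leaf f i = Leaf ->
  xgen (o + i)%N * forest_elt o (insert_leaf i f)
  = forest_elt o f * xgen (o + bound f i)%N.
Proof.
elim: i f o => [|i IH] f o fi.
  rewrite bound0 addn0 /= mul1g; case: f fi => [|t f] /= fi; first by rewrite mul1g mulg1.
  by rewrite fi /= !mul1g forest_elt_xgen addn1 //.
have fi' : nth Leaf (behead f) i = Leaf by case: (f) fi => [|? ?] //=; rewrite nth_nil.
rewrite /= mulgA xgen_tree_elt; last by lia.
have -> : forest_elt o f =
   tree_elt o (head Leaf f) * forest_elt (o + nleaves (head Leaf f))%N (behead f).
  by case: (f) => //=; rewrite mulg1.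
have -> : (o + bound f i.+1 = o + nleaves (head Leaf f) + bound (behead f) i)%N.
  by rewrite -addnA.
rewrite -!mulgA -IH //; congr (_ * (xgen _ * _)).
by have := nleaves_gt0 (head Leaf f); lia.
Qed.

Lemma forest_elt_nseq o k : forest_elt o (nseq k Leaf) = 1.
Proof. by elim: k o => //= k IH o; rewrite IH mulg1. Qed.

Lemma forest_elt_cat o f g :
  forest_elt o (f ++ g) = forest_elt o f * forest_elt (o + bound f (size f))%N g.
Proof.
elim: f o => [|t f IH] o /=; first by rewrite bound0 addn0 mul1g.
by rewrite IH mulgA -addnA.
Qed.

(** The pair [(A, B)] stands for the diagram with [A] in [T_-] and [B] in
    [T_+]; therefore right multiplication acts on [A]. *)
Definition pair_elt (A B : seq tree) : ThompsonF :=
  forest_elt 0 B * (forest_elt 0 A)^-1.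

Lemma pair_elt_join A B i : pair_elt (join i A) B = pair_elt A B * (xgen i)^-1.
Proof. by rewrite /pair_elt forest_elt_join invgM mulgA. Qed.

(** Splitting the leaf [bound A i] in both forests does not change the element,
    and multiplying by [xgen i] then removes the new caret from [A]. *)
Lemma pair_elt_insert A B i : nth Leaf A i = Leaf ->
  pair_elt (insert_leaf i A) (forest_expand (bound A i) B) = pair_elt A B * xgen i.
Proof.
move=> Ai; rewrite /pair_elt forest_elt_expand.
have := forest_elt_insert 0 Ai; rewrite !add0n => E.
have -> : forest_elt 0 (insert_leaf i A) = (xgen i)^-1 * (forest_elt 0 A * xgen (bound A i)).
  by rewrite -E mulgA mulVg mul1g.
by rewrite !invgM invgK !mulgA mulgK.
Qed.

Local Close Scope group_scope.

(** An arc [(x, x.+2)] is a caret of the forest with two leaves; common ones can be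
    cancelled. *)
Definition no_common_ear (A B : seq tree) : Prop :=
  forall x, (x, x.+2) \in forest_arcs 0 A -> (x, x.+2) \in forest_arcs 0 B -> False.

Definition narcs (A B : seq tree) : nat :=
  size (forest_arcs 0 A) + size (forest_arcs 0 B).

(** The padding covers the case in which [i] lies beyond the end of [f]. *)
Lemma insert_leaf_surj f i : nth Leaf f i = Leaf ->
  exists g k, insert_leaf i g = f ++ nseq k Leaf.
Proof.
elim: i f => [|i IH] [|t f] /=.
- by exists [::], 1.
- by move=> ->; exists f, 0; rewrite cats0.
- by move=> _; have [|g [k e]] := IH [::]; [rewrite nth_nil | exists (Leaf :: g), k.+1; rewrite /= e].
- by case/IH => g [k e]; exists (t :: g), k; rewrite /= e.
Qed.

Lemma nth_insert_leaf f i : nth Leaf (insert_leaf i f) i.+1 = nth Leaf f i.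
Proof. by elim: i f => [|i IH] [|t f] //=; rewrite IH ?nth_nil. Qed.

Lemma nth_cat_nseq f k i : nth Leaf (f ++ nseq k Leaf) i = nth Leaf f i.
Proof.
by rewrite nth_cat; case: ltnP => // fi; rewrite nth_nseq if_same nth_default.
Qed.

Lemma bound_cat_nseq f k i : bound (f ++ nseq k Leaf) i = bound f i.
Proof. by elim: i => // i IH; rewrite !boundS IH nth_cat_nseq. Qed.

Lemma forest_arcs_cat_nseq o f k : forest_arcs o (f ++ nseq k Leaf) = forest_arcs o f.
Proof. by rewrite forest_arcs_cat forest_arcs_nseq cats0. Qed.

Lemma forest_elt_cat_nseq o f k : forest_elt o (f ++ nseq k Leaf) = forest_elt o f.
Proof. by rewrite forest_elt_cat forest_elt_nseq mulg1. Qed.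

Section InsertExpand.
Variables (A B : seq tree) (i : nat).
Hypothesis Ai : nth Leaf A i = Leaf.
Let q := bound A i.

Lemma arcs_insert : forest_arcs 0 (insert_leaf i A) = bump_arcs q (forest_arcs 0 A).
Proof. exact: forest_arcs_insert. Qed.

Lemma arcs_expand : perm_eq (forest_arcs 0 (forest_expand q B))
  ((q, q.+2) :: bump_arcs q (forest_arcs 0 B)).
Proof. exact: (perm_forest_arcs_expand 0). Qed.

Lemma narcs_insert_expand :
  narcs (insert_leaf i A) (forest_expand q B) = (narcs A B).+1.
Proof.
by rewrite /narcs arcs_insert (perm_size arcs_expand) /= !size_map addnS.
Qed.

(** A leaf that is a tree of its own lies under no arc. *)
Lemma no_arc_over_leaf x y : (x, y) \in forest_arcs 0 A -> x <= q < y -> False.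
Proof.
move=> xy; rewrite leq_eqVlt => /andP[/orP[/eqP xq|xq] qy].
  by have /startsP := bound_leaf_starts 0 Ai; rewrite add0n -/q -xq; apply; exists y.
by have /exposedP := bound_exposed0 A i; apply; [apply: xy | |].
Qed.

(** The renumbering could change the length of an arc only if the arc covered the
    leaf [q]; the arcs of [A] do not. *)
Lemma no_common_ear_insert_expand :
  no_common_ear A B <-> no_common_ear (insert_leaf i A) (forest_expand q B).
Proof.
rewrite /no_common_ear; split=> H x.
  rewrite arcs_insert (perm_mem arcs_expand) inE => /bump_arcsP[x' [y' [xx' yy' xy]]].
  have [_ y'x'] := forest_arcs_bounds xy.
  have e : y' = x'.+2 by move: xx' yy' y'x'; rewrite /bump; lia.
  rewrite e in xy yy'.
  case/orP => [/eqP[xq _]|].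
    by apply: (no_arc_over_leaf xy); move: xx'; rewrite xq /bump; lia.
  by rewrite yy' xx' mem_bump_arcs; apply: H.
move=> xA xB; have := @no_arc_over_leaf _ _ xA => over.
have e : bump q.+1 x.+2 = (bump q.+1 x).+2.
  by rewrite /bump; lia.
apply: (H (bump q.+1 x)); rewrite -e.
  by rewrite arcs_insert mem_bump_arcs.
by rewrite (perm_mem arcs_expand) inE mem_bump_arcs xB orbT.
Qed.

End InsertExpand.

(** Read backwards, the cancellation inserts a leaf in [A'] and splits a leaf of
    [B']. *)
Lemma cancel_ear n A B i :
    nth Leaf A i = Leaf -> nth Leaf A i.+1 = Leaf ->
    (bound A i, (bound A i).+2) \in forest_arcs 0 B -> no_common_ear A B ->
  exists A' B', [/\ no_common_ear A' B',
    forall k, pair_weight_le n (forest_arcs 0 A) (forest_arcs 0 B) k ->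
      pair_weight_le n (forest_arcs 0 A') (forest_arcs 0 B') k,
    i <= n -> forall k, pair_weight_le n (forest_arcs 0 A') (forest_arcs 0 B') k ->
      pair_weight_le n (forest_arcs 0 A) (forest_arcs 0 B) k,
    (pair_elt A' B' = pair_elt A B * (xgen i)^-1)%g & narcs A B = (narcs A' B').+1].
Proof.
move=> Ai Ai1 ear red.
have [g [m eA]] := insert_leaf_surj Ai.
have gi : nth Leaf g i = Leaf by rewrite -(nth_insert_leaf g i) eA nth_cat_nseq.
have gA : bound g i = bound A i.
  by rewrite -(bound_insert_le g (leqnn i)) eA bound_cat_nseq.
have [h eB] := forest_expand_surj (ear : (0 + _, (0 + _).+2) \in _).
have arcsA : forest_arcs 0 A = forest_arcs 0 (insert_leaf i g).
  by rewrite eA forest_arcs_cat_nseq.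
exists g, h; rewrite -gA in eB; rewrite eB in red *; split.
- apply/(no_common_ear_insert_expand _ gi).
  by move=> x; rewrite -arcsA; apply: red.
- move=> k pw; apply: (@weight_le_contract_arcs (bound g i)); rewrite -arcs_insert // -arcsA.
  by apply: pair_weight_le_eqi pw => // e; rewrite (perm_mem (arcs_expand g h i)).
- move=> i_n k /(weight_le_expand_arcs i_n gi); rewrite arcsA arcs_insert //.
  by apply: pair_weight_le_eqi => // e; rewrite (perm_mem (arcs_expand g h i)).
- rewrite -[pair_elt g h](mulgK (xgen i)) -pair_elt_insert // /pair_elt.
  by rewrite eA forest_elt_cat_nseq.
- by rewrite -(narcs_insert_expand _ gi) /narcs arcsA.
Qed.

(** Only the new arc can be a common ear, and it covers two leaves only if it joins
    two trees that are leaves. *)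
Lemma join_ear A B i : no_common_ear A B ->
  no_common_ear (join i A) B \/
  [/\ nth Leaf A i = Leaf, nth Leaf A i.+1 = Leaf &
      (bound A i, (bound A i).+2) \in forest_arcs 0 B].
Proof.
move=> red; have [|] := pselect (no_common_ear (join i A) B); first by left.
move=> nred; right; apply: contrapT => near; apply: nred => x.
rewrite (perm_mem (perm_forest_arcs_join 0 _ _)) inE => /orP[/eqP[xi xi2]|]; last exact: red.
rewrite !add0n in xi xi2; move=> xB; apply: near; rewrite -xi.
have := xi2; rewrite 2!boundS -xi.
have := nleaves_gt0 (nth Leaf A i); have := nleaves_gt0 (nth Leaf A i.+1) => ? ? ?.
by split=> //; apply: nleaves1; lia.
Qed.

Lemma narcs_join A B i : narcs (join i A) B = (narcs A B).+1.
Proof. by rewrite /narcs (perm_size (perm_forest_arcs_join 0 _ _)). Qed.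

Lemma no_common_ear_of_join A B i : no_common_ear (join i A) B -> no_common_ear A B.
Proof.
by move=> red x xA; apply: red; rewrite (perm_mem (perm_forest_arcs_join 0 _ _)) inE xA orbT.
Qed.

Lemma weight_le_join_forest n A B i k :
  pair_weight_le n ((bound A i, bound A i.+2) :: forest_arcs 0 A) (forest_arcs 0 B) k ->
  pair_weight_le n (forest_arcs 0 (join i A)) (forest_arcs 0 B) k.
Proof.
move=> pw; apply: pair_weight_le_eqi pw => // e.
by rewrite (perm_mem (perm_forest_arcs_join 0 _ _)).
Qed.

Definition letter_elt i (e : bool) : ThompsonF := if e then (xgen i)^-1%g else xgen i.

(** The inequality bounds the old length by the new one.  Applied along the
    inverse of a word for an element, down to a pair without arcs, it bounds the
    length formula for that element by the number of letters. *)
Lemma length_step n A B i e : i <= n -> no_common_ear A B ->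
  exists A' B', [/\ no_common_ear A' B',
    (pair_elt A' B' = pair_elt A B * letter_elt i e)%g
    & forall k', pair_weight_le n (forest_arcs 0 A') (forest_arcs 0 B') k' ->
      exists2 k, pair_weight_le n (forest_arcs 0 A) (forest_arcs 0 B) k
        & narcs A B + k.*2 <= (narcs A' B' + k'.*2).+1].
Proof.
move=> i_n red; case: e => /=.
  case: (join_ear i red) => [red'|[Ai Ai1 ear]].
    exists (join i A), B; split=> // [|k' pw]; first exact: pair_elt_join.
    exists k'.+1; last by rewrite narcs_join; lia.
    apply: (weight_le_split i_n); apply: pair_weight_le_eqi pw => // e.
    by rewrite (perm_mem (perm_forest_arcs_join 0 _ _)).
  have [A' [B' [red' _ pw' eq' sz]]] := cancel_ear n Ai Ai1 ear red.
  by exists A', B'; split=> // k' /(pw' i_n) pw; exists k'; rewrite ?sz.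
case Ai : (nth Leaf A i) => [|t1 t2].
  exists (insert_leaf i A), (forest_expand (bound A i) B); split.
  - exact/(no_common_ear_insert_expand _ Ai).
  - exact: pair_elt_insert.
  - move=> k' pw; exists k'; last by rewrite (narcs_insert_expand _ Ai); lia.
    apply: (@weight_le_contract_arcs (bound A i)); rewrite -arcs_insert //.
    by apply: pair_weight_le_eqi pw => // e; rewrite (perm_mem (arcs_expand A B i)).
have [A' eA] : exists A', A = join i A' by apply: join_surj; rewrite Ai.
exists A', B; rewrite eA in red *; split.
- exact: no_common_ear_of_join red.
- by rewrite pair_elt_join /letter_elt mulgVK.
- move=> k' pw; exists k'; last by rewrite narcs_join.
  exact: (weight_le_join_forest (weight_le_join i_n pw)).
Qed.

(** [weight_descent] also allows a join at the root that creates a common ear;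
    cancelling this ear is then an even better move. *)
Lemma length_descent n A B k : 0 < n -> 0 < narcs A B ->
    no_common_ear A B -> pair_weight_le n (forest_arcs 0 A) (forest_arcs 0 B) k ->
  exists i e A' B' k', i <= n /\ [/\ no_common_ear A' B',
    pair_weight_le n (forest_arcs 0 A') (forest_arcs 0 B') k',
    (pair_elt A' B' = pair_elt A B * letter_elt i e)%g
    & narcs A' B' + k'.*2 < narcs A B + k.*2].
Proof.
move=> n0 ab red pw.
have nnil : forest_arcs 0 A ++ forest_arcs 0 B <> [::].
  by move=> /(congr1 size); rewrite size_cat -/(narcs A B) /=; lia.
case: (weight_descent n0 nnil pw) => [[k' kk' pw']|[i i_n [A' eA pw']]|[i i_n [Ai Ai1 ear]]].
- case: (join_ear 0 red) => [red'|[Ai Ai1 ear]].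
    exists 0, true, (join 0 A), B, k'; split=> //; split=> //; last by rewrite narcs_join; lia.
      exact: (weight_le_join_forest pw').
    exact: pair_elt_join.
  have [A' [B' [? /(_ _ pw) ? _ ? ?]]] := cancel_ear n Ai Ai1 ear red.
  by exists 0, true, A', B', k; split=> //; split=> //; lia.
- rewrite eA in red *; exists i, false, A', B, k; split=> //; split=> //.
  + exact: no_common_ear_of_join red.
  + by rewrite pair_elt_join mulgVK.
  + by rewrite narcs_join; lia.
- have [A' [B' [? /(_ _ pw) ? _ ? ?]]] := cancel_ear n Ai Ai1 ear red.
  by exists i, true, A', B', k; split=> //; split=> //; lia.
Qed.

(** * Addresses and intervals of leaves *)

(** The node with address [e] covers the leaves numbered from [node_start t e] to
    [node_end t e - 1]. *)
Fixpoint node_start (t : tree) (e : address) {struct e} : nat :=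
  match e, t with
  | b :: e', Caret l r => if b then nleaves l + node_start r e' else node_start l e'
  | _, _ => 0
  end.

Fixpoint subtree (t : tree) (e : address) {struct e} : tree :=
  match e, t with
  | b :: e', Caret l r => subtree (if b then r else l) e'
  | _, _ => t
  end.

Definition node_end (t : tree) (e : address) : nat := node_start t e + nleaves (subtree t e).

Lemma subtree_Leaf e : subtree Leaf e = Leaf. Proof. by case: e. Qed.

Lemma node_start_Leaf e : node_start Leaf e = 0. Proof. by case: e. Qed.

Lemma subtree_cat t e s : subtree t (e ++ s) = subtree (subtree t e) s.
Proof. by elim: e t => [|b e IH] [|l r] //=; rewrite subtree_Leaf. Qed.

Lemma node_start_cat t e s : node_start t (e ++ s) = node_start t e + node_start (subtree t e) s.
Proof.
elim: e t => [|b e IH] [|l r] //=; first by rewrite node_start_Leaf.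
by case: b; rewrite IH ?addnA.
Qed.

Lemma node_end_cat t e s : node_end t (e ++ s) = node_start t e + node_end (subtree t e) s.
Proof. by rewrite /node_end node_start_cat subtree_cat addnA. Qed.

Lemma size_leaves t : size (leaves t) = nleaves t.
Proof. by elim: t => //= l <- r <-; rewrite size_cat !size_map. Qed.

Lemma ncarets_Caret l r : ncarets (Caret l r) = (ncarets l + ncarets r).+1.
Proof. by rewrite /ncarets /= size_cat /= !size_map addnS. Qed.

Lemma nleaves_ncarets t : nleaves t = (ncarets t).+1.
Proof. by elim: t => // l IHl r IHr; rewrite ncarets_Caret /= IHl IHr addnS. Qed.

Lemma carets_Caret_cons l r b c :
  (b :: c \in carets (Caret l r)) = (c \in carets (if b then r else l)).
Proof.
have inj b' : injective (cons b' : address -> address) by move=> ? ? [].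
have other b' b'' c' s : b' != b'' -> (b' :: c' \in [seq b'' :: x | x <- s]) = false.
  by move=> ne; apply/mapP => -[x _ [e _]]; rewrite e eqxx in ne.
rewrite /= mem_cat inE /=; case: b; rewrite (mem_map (inj _)) other ?orbF //.
Qed.

Lemma mem_carets t c : (c \in carets t) = (subtree t c != Leaf).
Proof.
elim: t c => [|l IHl r IHr] c; first by rewrite subtree_Leaf.
case: c => [|b c]; first by rewrite /= mem_cat inE eqxx orbT.
by rewrite carets_Caret_cons /=; case: b.
Qed.

Lemma caret_child t c : c \in carets t ->
  exists l r, [/\ subtree t c = Caret l r, subtree t (rcons c false) = l &
    subtree t (rcons c true) = r].
Proof.
rewrite mem_carets -!cats1 !subtree_cat; case: (subtree t c) => // l r _.
by exists l, r; split.
Qed.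

(** In infix order the number of a caret is the number of leaves to the left of its
    right subtree, that is [node_start t (rcons c true)]. *)
Lemma caret_number_bounds t c : c \in carets t -> 0 < node_start t (rcons c true) <= ncarets t.
Proof.
elim: t c => // l IHl r IHr [_|b c]; rewrite ncarets_Caret /=.
  by have := nleaves_ncarets l; lia.
rewrite carets_Caret_cons; case: b => [/IHr|/IHl] /=; have := nleaves_ncarets l; lia.
Qed.

Lemma nth_caret t c : c \in carets t -> caret t (node_start t (rcons c true)) = c.
Proof.
rewrite /caret; elim: t c => // l IHl r IHr [_|b c] /=; rewrite nth_cat size_map.
  by case: (r) => [|? ?] /=; rewrite nleaves_ncarets addn0 /= ltnn subnn.
rewrite -/(carets (Caret l r)) carets_Caret_cons; case: b => cin /=.
  have := caret_number_bounds cin; rewrite nleaves_ncarets => /andP[n0 n1].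
  rewrite -/(ncarets l); move: n0 n1 (IHr c cin); set x := node_start r _ => n0 n1 <-.
  rewrite ifN; last by lia.
  have -> : ((ncarets l).+1 + x).-1 - ncarets l = x.-1.+1 by lia.
  by rewrite /= (nth_map [::]) // -/(ncarets r); lia.
have /andP[n0 n1] := caret_number_bounds cin.
rewrite -/(ncarets l); move: n0 n1 (IHl c cin); set x := node_start l _ => n0 n1 <-.
rewrite ifT; last by lia.
by rewrite (nth_map [::]) // -/(ncarets l); lia.
Qed.

Lemma node_start_nth_caret t k : k < ncarets t -> node_start t (rcons (nth [::] (carets t) k) true) = k.+1.
Proof.
elim: t k => // l IHl r IHr k; rewrite ncarets_Caret /= nth_cat size_map -/(ncarets l).
case: (ltnP k (ncarets l)) => [kl _|lk kr]; first by rewrite (nth_map [::]) //= IHl.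
case E : (k - ncarets l) => [|j] /=.
  by rewrite nleaves_ncarets; lia.
have jr : j < ncarets r by lia.
by rewrite (nth_map [::]) //= IHr // nleaves_ncarets; lia.
Qed.

Lemma caret_mem t p : is_caret t p -> caret t p \in carets t.
Proof. by case/andP => p0 pN; apply: mem_nth; case: p p0 pN. Qed.

Lemma caret_number t p : is_caret t p -> node_start t (rcons (caret t p) true) = p.
Proof. by case/andP; case: p => // p _ pN; rewrite node_start_nth_caret. Qed.

Lemma mem_edges t c b : (rcons c b \in edges t) = (c \in carets t).
Proof.
apply/flattenP/idP => [[s /mapP[c' c'in ->]]|cin].
  by rewrite !inE => /orP[] /eqP/rcons_inj[-> _].
by exists [:: rcons c false; rcons c true]; [apply: map_f | case: b; rewrite !inE eqxx ?orbT].
Qed.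

Lemma caret_prefix t c s : c ++ s \in carets t -> c \in carets t.
Proof.
by rewrite !mem_carets subtree_cat; case: (subtree t c) => //; rewrite subtree_Leaf.
Qed.

Lemma edge_prefix t c b s : rcons c b ++ s \in edges t -> c \in carets t.
Proof.
case/lastP: s => [|s x]; first by rewrite cats0 mem_edges.
by rewrite -rcons_cat mem_edges -cats1 -catA => /caret_prefix.
Qed.

Lemma caret_edge t c : c \in carets t -> c = [::] \/ c \in edges t.
Proof.
case/lastP: c => [|c b] cin; first by left.
by right; rewrite mem_edges; apply: (@caret_prefix _ _ [:: b]); rewrite cats1.
Qed.

Lemma node_start_all_left t s : all negb s -> node_start t s = 0.
Proof. by elim: s t => [|[] s IH] [|l r] //= s0; apply: IH. Qed.

Lemma node_end_all_right t s : all id s -> node_end t s = nleaves t.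
Proof.
elim: s t => [|[] s IH] [|l r] //=; rewrite /node_end ?addn0 //= => /(IH r); rewrite /node_end /=; lia.
Qed.

Lemma last_right (s : address) : ~~ all negb s ->
  exists c s', s = rcons c true ++ s' /\ all negb s'.
Proof.
elim/last_ind: s => // s [] IH; first by exists s, [::]; rewrite cats0.
rewrite all_rcons /= => /IH[c [s' [-> s'0]]]; exists c, (rcons s' false).
by rewrite rcons_cat all_rcons.
Qed.

Lemma last_left (s : address) : ~~ all id s ->
  exists c s', s = rcons c false ++ s' /\ all id s'.
Proof.
elim/last_ind: s => // s [] IH; last by exists s, [::]; rewrite cats0.
rewrite all_rcons /= => /IH[c [s' [-> s'0]]]; exists c, (rcons s' true).
by rewrite rcons_cat all_rcons.
Qed.

Lemma node_start_rcons_false t c : node_start t (rcons c false) = node_start t c.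
Proof. by rewrite -cats1 node_start_cat (@node_start_all_left _ [:: false]) ?addn0. Qed.

Lemma node_end_left_child t c : c \in carets t -> node_end t (rcons c false) = node_start t (rcons c true).
Proof.
move=> /caret_child[l [r [sc lc rc]]].
by rewrite /node_end lc node_start_rcons_false -!cats1 node_start_cat sc /= addn0.
Qed.

Lemma node_start_right_edge t c s : all negb s -> node_start t (rcons c true ++ s) = node_start t (rcons c true).
Proof. by move=> s0; rewrite node_start_cat (node_start_all_left _ s0) addn0. Qed.

Lemma node_end_left_edge t c s : c \in carets t -> all id s ->
  node_end t (rcons c false ++ s) = node_start t (rcons c true).
Proof. by move=> cin s1; rewrite node_end_cat node_end_all_right // -node_end_left_child. Qed.

Lemma subtree_prefix_caret t c b s : 
  rcons c b ++ s \in edges t \/ rcons c b ++ s \in carets t -> c \in carets t.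
Proof.
case=> [/edge_prefix //|]; rewrite -cats1 -catA; exact: caret_prefix.
Qed.

(* Nodes reached by at least one right step start at the number of a caret. *)
(** Left steps do not move the first leaf, so a node starts at the number of the
    caret of its last right step; the caret of its last left step marks its end. *)
Lemma node_start_right_step t e : e \in edges t \/ e \in carets t -> ~~ all negb e ->
  exists c s, [/\ e = rcons c true ++ s, all negb s, c \in carets t
    & node_start t e = node_start t (rcons c true)].
Proof.
move=> ein /last_right[c [s [ee s0]]]; exists c, s; rewrite ee in ein *.
by split=> //; [apply: subtree_prefix_caret ein | rewrite node_start_right_edge].
Qed.

Lemma node_end_left_step t e : e \in edges t \/ e \in carets t -> ~~ all id e ->
  exists c s, [/\ e = rcons c false ++ s, all id s, c \in carets t
    & node_end t e = node_start t (rcons c true)].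
Proof.
move=> ein /last_left[c [s [ee s0]]]; exists c, s; rewrite ee in ein *.
have cin := subtree_prefix_caret ein.
by split=> //; rewrite node_end_left_edge.
Qed.

Lemma node_start_eq0 t e : e \in edges t \/ e \in carets t -> (node_start t e == 0) = all negb e.
Proof.
move=> ein; apply/eqP/idP => [e0|/node_start_all_left->//].
apply: contraT => /(node_start_right_step ein)[c [s [_ _ cin]]].
by have := caret_number_bounds cin; rewrite e0 => + e1; rewrite -e1.
Qed.

Lemma node_end_le_ncarets t e : e \in edges t \/ e \in carets t -> (node_end t e <= ncarets t) = ~~ all id e.
Proof.
move=> ein; apply/idP/idP => [he|/(node_end_left_step ein)[c [s [_ _ cin ->]]]].
  by apply/negP => /(node_end_all_right t) e1; move: he; rewrite e1 nleaves_ncarets ltnn.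
by case/andP: (caret_number_bounds cin).
Qed.

(** The arcs of a tree are the intervals of its carets. *)
Lemma mem_tree_arcs o t x y : reflect
  (exists2 c, c \in carets t & x = o + node_start t c /\ y = o + node_end t c)
  ((x, y) \in tree_arcs o t).
Proof.
apply: (iffP idP).
  elim: t o => //= l IHl r IHr o; rewrite inE mem_cat -/(carets (Caret l r)).
  case/or3P => [/eqP[-> ->]|/IHl[c cin [-> ->]]|/IHr[c cin [-> ->]]].
  - by exists [::]; rewrite ?mem_carets //= addn0.
  - by exists (false :: c); rewrite ?carets_Caret_cons.
  - by exists (true :: c); rewrite ?carets_Caret_cons //= /node_end /= !addnA.
elim: t o x y => [|l IHl r IHr] o x y [c] //; case: c => [_ [-> ->]|b c].
  by rewrite /= inE /node_end /= addn0 eqxx.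
rewrite carets_Caret_cons => cin [-> ->]; rewrite [tree_arcs _ _]/= inE mem_cat; apply/or3P.
case: b cin => cin; last by apply/Or32/IHl; exists c.
by apply/Or33/IHr; exists c; rewrite // /node_end /= !addnA.
Qed.

Lemma leaf_node t k : k < nleaves t ->
  exists2 e, e \in edges t \/ t = Leaf & node_start t e = k /\ node_end t e = k.+1.
Proof.
suff H : k < nleaves t -> exists e, [/\ node_start t e = k, subtree t e = Leaf
    & forall c b s, e = rcons c b ++ s -> subtree t c <> Leaf].
  move=> /H[e [le se He]]; exists e; last by rewrite /node_end le se addn1.
  case: (lastP e) se He => [/= ->|c b _ He]; first by right.
  by left; rewrite mem_edges mem_carets; apply/eqP/(He c b [::]); rewrite cats0.
elim: t k => [|l IHl r IHr] k /=; first by case: k => // _; exists [::]; split=> // -[].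
move=> kt; have [kl|lk] := ltnP k (nleaves l).
  have [e [le se He]] := IHl k kl; exists (false :: e); split=> // -[//|b' c] b s [eb /= e1].
  by rewrite -eb; apply: He e1.
have [|e [le se He]] := IHr (k - nleaves l); first by lia.
exists (true :: e); split=> //=; first by rewrite le subnKC.
by move=> [//|b' c] b s [<- /=]; apply: He.
Qed.

Lemma node_end_le t e : e \in carets t -> node_end t e <= nleaves t.
Proof.
move=> ein; have : (0 + node_start t e, 0 + node_end t e) \in tree_arcs 0 t.
  by apply/mem_tree_arcs; exists e.
by case/tree_arcs_bounds.
Qed.

(** A caret numbered strictly inside the interval of a node lies below the node. *)
Lemma inside_node t e c : c \in carets t ->
  e \in carets t -> node_start t e < node_start t (rcons c true) < node_end t e -> prefix e c.
Proof.
elim: t e c => // l IHl r IHr [|b e] c; first by rewrite prefix0s.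
rewrite carets_Caret_cons; case: c => [_|b' c].
  by case: b => /node_end_le; rewrite /node_end /=; lia.
rewrite carets_Caret_cons prefix_cons; case: b b' => -[] cin ein.
- by move=> H; apply: IHr => //; move: H; rewrite /node_end /=; lia.
- have := caret_number_bounds cin; have := nleaves_ncarets l; rewrite /node_end /=; lia.
- have := caret_number_bounds cin; have := nleaves_ncarets l.
  by have := node_end_le ein; rewrite /node_end /=; lia.
- by move=> H; apply: IHl.
Qed.

Lemma prefix_inside t e s : e ++ s \in carets t ->
  node_start t e < node_start t (rcons (e ++ s) true) < node_end t e.
Proof.
rewrite mem_carets subtree_cat -mem_carets rcons_cat node_start_cat => /caret_number_bounds.
by rewrite /node_end nleaves_ncarets; lia.
Qed.

(** * Trees as forests *)

Fixpoint spine (t : tree) : seq tree :=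
  if t is Caret l r then l :: spine r else [::].

(** Every tree is determined by the left subtrees of its right carets, from the
    root down. *)
Definition unspine (f : seq tree) : tree := foldr Caret Leaf f.

Lemma unspineK : cancel unspine spine.
Proof. by elim=> //= t f ->. Qed.

Definition spine_arcs (t : tree) : seq (nat * nat) := forest_arcs 0 (spine t).

(** The right carets are the ones whose interval extends to the last leaf. *)
Lemma forest_arcs_spine o t x y :
  ((x, y) \in forest_arcs o (spine t)) = ((x, y) \in tree_arcs o t) && (y < o + nleaves t).
Proof.
elim: t o => //= l _ r IHr o; rewrite mem_cat inE mem_cat IHr -addnA xpair_eqE.
case: (y =P o + _) => [->|_]; rewrite ?ltnn ?andbF ?orbF //=.
  by apply/negP => /tree_arcs_bounds[]; have := nleaves_gt0 r; lia.
rewrite andb_orl; congr (_ || _); apply/idP/andP => [xy|[]//].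
by split=> //; have [_ _] := tree_arcs_bounds xy; have := nleaves_gt0 r; lia.
Qed.

Lemma spine_arcsE t x y :
  ((x, y) \in spine_arcs t) = ((x, y) \in tree_arcs 0 t) && (y <= ncarets t).
Proof. by rewrite forest_arcs_spine nleaves_ncarets. Qed.

Lemma spine_arcsP t x y : reflect
  (exists2 c, c \in carets t & [/\ x = node_start t c, y = node_end t c & y <= ncarets t])
  ((x, y) \in spine_arcs t).
Proof.
rewrite spine_arcsE; apply: (iffP andP) => [[/mem_tree_arcs[c cin [-> ->]] le]|[c cin [-> -> le]]].
  by exists c.
by split=> //; apply/mem_tree_arcs; exists c.
Qed.

(** The nodes that end before the last leaf are the arcs of the forest and the
    leaves, which give the edges between consecutive gaps. *)
Lemma node_edge t x y : 0 < y <= ncarets t ->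
  (exists2 e, e \in edges t & node_start t e = x /\ node_end t e = y) <-> edge (spine_arcs t) x y.
Proof.
move=> /andP[y0 yN]; split=> [[e ein [ex ey]]|/orP[/eqP yx|/spine_arcsP[c cin [cx cy _]]]].
- rewrite /edge; case: (boolP (e \in carets t)) => ce.
    by apply/orP; right; apply/spine_arcsP; exists e.
  by move: ce ey; rewrite mem_carets negbK /node_end => /eqP->; rewrite ex addn1 => <-; rewrite eqxx.
- have [|e [ein|t0] [le he]] := @leaf_node t x; first by rewrite nleaves_ncarets; lia.
    by exists e => //; rewrite le he yx.
  by move: yN; rewrite t0 /ncarets /=; lia.
- case: (caret_edge cin) => [c0|cin']; last by exists c.
  by move: yN; rewrite cy c0 /node_end /= nleaves_ncarets ltnn.
Qed.

Lemma generalizedP t c b e : reflect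
  (e \in edges t /\ exists2 s, e = rcons c b ++ s & all (pred1 (~~ b)) s)
  (e \in generalized_edge t c b).
Proof.
rewrite mem_filter -andbA; apply: (iffP and3P).
  case=> /prefixP[s es] alls ein; split=> //; exists s => //.
  by move: alls; rewrite es -(size_rcons c b) drop_size_cat.
case=> ein [s es alls]; split=> //; first by rewrite es prefix_prefix.
by rewrite es -(size_rcons c b) drop_size_cat.
Qed.

Lemma all_pred1_false s : all (pred1 false) s = all negb s.
Proof. by apply: eq_all => -[]. Qed.

Lemma all_pred1_true s : all (pred1 true) s = all id s.
Proof. by apply: eq_all => -[]. Qed.

(** The edges of the generalized right edge of [p] are the nodes that start at [p],
    and those of the generalized left edge of [q] are the nodes that end at
    [q]. *)
Lemma adjacent_in_edge t p q : is_caret t p -> is_caret t q ->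
  adjacent_in t p q = edge (spine_arcs t) p q.
Proof.
move=> pin qin; apply/hasP/idP => [[e /generalizedP[ein [s es s0]] e']|].
  move: e' => /generalizedP[_ [s' es' s'1]].
  apply/(node_edge p qin); exists e => //; split.
    by rewrite es node_start_right_edge -?all_pred1_false // caret_number.
  by rewrite es' node_end_left_edge -?all_pred1_true ?caret_number // caret_mem.
move=> /(node_edge p qin)[e ein [ep eq]].
have ein' : e \in edges t \/ e \in carets t by left.
have [|c [s [es s0 cin ec]]] := node_start_right_step ein'.
  by rewrite -(node_start_eq0 ein') ep; case/andP: pin; case: (p).
have [|c' [s' [es' s'1 cin' ec']]] := node_end_left_step ein'.
  by rewrite -(node_end_le_ncarets ein') eq; case/andP: qin.
have cp : caret t p = c by rewrite -ep ec nth_caret.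
have cq : caret t q = c' by rewrite -eq ec' nth_caret.
exists e.
  by apply/generalizedP; split=> //; exists s; rewrite ?cp // all_pred1_false.
by apply/generalizedP; split=> //; exists s'; rewrite ?cq // all_pred1_true.
Qed.

(** The dummy caret behaves as vertex 0: the nodes that start at gap 0 are the ones
    on the left side. *)
Lemma left_caret_edge t q : left_caret t q = is_caret t q && edge (spine_arcs t) 0 q.
Proof.
rewrite /left_caret; case qin : (is_caret t q) => //=; set c := caret t q.
have cin : c \in carets t by apply: caret_mem.
apply/idP/idP => [c0|/(node_edge 0 qin)[e ein [e0 eq]]].
  apply/(node_edge 0 qin); exists (rcons c false); first by rewrite mem_edges.
  by rewrite node_start_rcons_false node_start_all_left // node_end_left_child // caret_number.
have ein' : e \in edges t \/ e \in carets t by left.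
have [|c' [s' [es' s'1 cin' ec']]] := node_end_left_step ein'.
  by rewrite -(node_end_le_ncarets ein') eq; case/andP: qin.
have cq : c = c' by rewrite /c -eq ec' nth_caret.
have : all negb e by rewrite -(node_start_eq0 ein') e0.
by rewrite es' all_cat all_rcons cq /= => /andP[].
Qed.

Lemma node_start_lt_number t c : c \in carets t -> node_start t c < node_start t (rcons c true).
Proof.
case/caret_child => l [r [sc _ _]]; rewrite -cats1 node_start_cat sc /= addn0.
by have := nleaves_gt0 l; lia.
Qed.

(** If [p.+1] lies in the right subtree of [p], then its own subtree starts at gap
    [p], because no caret is numbered between them.  It is the arc wanted, as an
    interior caret ends before the last leaf. *)
Lemma type_NE t p : type_N t p = (0 < p) && starts (spine_arcs t) p.
Proof.
apply/and4P/andP => [[pin qin /and3P[_ nl nr] pre]|[p0 /startsP[q /spine_arcsP[e ein [ep eq qN]]]]].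
  set c := caret t p in pre; set c' := caret t p.+1 in pre.
  have cin : c \in carets t by apply: caret_mem.
  have cin' : c' \in carets t by apply: caret_mem.
  rewrite (proj1 (andP pin)); split=> //; apply/startsP; exists (node_end t c').
  have cin'' : c' \in edges t \/ c' \in carets t by right.
  apply/spine_arcsP; exists c' => //; split=> //.
    have := node_start_lt_number cin'; rewrite caret_number // ltnS => le.
    apply/eqP; rewrite eqn_leq le andbT.
    case/prefixP: pre => s es; rewrite /c' es node_start_cat -{1}(caret_number pin); exact: leq_addr.
  by rewrite node_end_le_ncarets //; move: nr; rewrite /right_caret qin.
have ein' : e \in edges t \/ e \in carets t by right.
have [_ pq] : 0 <= p /\ p.+2 <= q.
  by apply: (@forest_arcs_bounds 0 (spine t)); apply/spine_arcsP; exists e.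
have pin : is_caret t p by rewrite /is_caret p0; lia.
have qin : is_caret t p.+1 by rewrite /is_caret; lia.
have ne0 : ~~ all negb e by rewrite -(node_start_eq0 ein') -ep -lt0n.
have ne1 : ~~ all id e by rewrite -(node_end_le_ncarets ein') -eq.
have pre : prefix e (caret t p.+1).
  apply: inside_node; [exact: caret_mem | exact: ein |].
  by rewrite caret_number // -ep -eq; lia.
have [s cs] := prefixP pre.
split=> //.
  apply/and3P; split=> //; rewrite ?/left_caret ?/right_caret qin /= cs.
    by rewrite /on_left_side all_cat negb_and ne0.
  by rewrite /on_right_side all_cat negb_and ne1.
rewrite /in_right_subtree.
have [c [s' [es s0 cin ec]]] := node_start_right_step ein' ne0.
have -> : caret t p = c by rewrite ep ec nth_caret.
by apply: prefix_trans pre; rewrite es prefix_prefix.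
Qed.

(** A caret off the right side lies below some left child, whose interval jumps
    over its number. *)
Lemma right_caretE t p : right_caret t p = is_caret t p && exposed (spine_arcs t) p.
Proof.
rewrite /right_caret; case pin : (is_caret t p) => //=; set c := caret t p.
have cin : c \in carets t by apply: caret_mem.
apply/idP/exposedP => [c1 x y /spine_arcsP[e ein [-> -> hiN]] xp py|ex].
  have /prefixP[s es] : prefix e c by apply: (inside_node cin ein); rewrite caret_number // xp.
  move: hiN; rewrite (node_end_le_ncarets (or_intror ein)) => /negP; apply.
  by move: c1; rewrite es /on_right_side all_cat => /andP[].
rewrite /on_right_side; apply: contraT => c1.
have [c0 [s [cs s1 c0in _]]] := node_end_left_step (or_intror cin) c1.
have ein : rcons c0 false \in carets t.
  by apply: (@caret_prefix _ _ s); rewrite -cs.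
have := @prefix_inside t (rcons c0 false) s; rewrite -cs caret_number // => /(_ cin).
case/andP => xp py; exfalso; apply: ex xp py; apply/spine_arcsP.
exists (rcons c0 false) => //; split=> //; rewrite (node_end_le_ncarets (or_intror ein)).
by rewrite all_rcons.
Qed.

Lemma node_start_leaf t k : k < nleaves t ->
  leaf t k \in leaves t /\ node_start t (leaf t k) = k.
Proof.
move=> kt; split; first by apply: mem_nth; rewrite size_leaves.
rewrite /leaf; elim: t k kt => [|l IHl r IHr] k /=; first by case: k.
move=> kt; rewrite nth_cat size_map size_leaves; case: ltnP => kl.
  by rewrite (nth_map [::]) ?size_leaves //= IHl.
by rewrite (nth_map [::]) ?size_leaves /= ?IHr ?subnKC //; lia.
Qed.

Lemma leaf_node_start t e : e \in leaves t -> leaf t (node_start t e) = e /\ subtree t e = Leaf.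
Proof.
rewrite /leaf; elim: t e => [|l IHl r IHr] e /=; first by rewrite inE => /eqP->.
have lt_lo t' e' : e' \in leaves t' -> node_start t' e' < nleaves t'.
  elim: t' e' => [|l' IHl' r' IHr'] e' /=; first by rewrite inE => /eqP->.
  by rewrite mem_cat => /orP[] /mapP[e'' /[swap] -> /=] => [/IHl'|/IHr']; have := nleaves_gt0 r'; lia.
rewrite mem_cat => /orP[] /mapP[e' ein ->] /=; rewrite nth_cat size_map size_leaves.
  by have [E ->] := IHl _ ein; rewrite lt_lo // (nth_map [::]) ?size_leaves ?lt_lo // E.
have [E ->] := IHr _ ein; rewrite ltnNge leq_addr /= addKn.
by rewrite (nth_map [::]) ?size_leaves ?lt_lo // E.
Qed.

Lemma mem_leaves_child t c b : c \in carets t -> subtree t (rcons c b) = Leaf ->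
  rcons c b \in leaves t.
Proof.
elim: t c => // l IHl r IHr c.
case: c => [_ /=|b' c]; first by rewrite mem_cat; case: (b) => ->; rewrite mem_seq1 eqxx ?orbT.
rewrite carets_Caret_cons /= mem_cat; case: b' => cin se.
  by rewrite (map_f (cons true) (IHr _ cin se)) orbT.
by rewrite (map_f (cons false) (IHl _ cin se)).
Qed.

Lemma exposed_atE t i : exposed_at t i = ((i, i.+2) \in tree_arcs 0 t).
Proof.
apply/hasP/mem_tree_arcs => [[c cin /andP[/eqP li /eqP li1]]|[c cin]].
  exists c => //; have i0 : i < size (leaves t).
    by rewrite ltnNge; apply/negP => H; move: li; rewrite /leaf nth_default //; case: (c).
  have i1 : i.+1 < size (leaves t).
    by rewrite ltnNge; apply/negP => H; move: li1; rewrite /leaf nth_default //; case: (c).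
  rewrite size_leaves in i0 i1.
  have [in0 lo0] := node_start_leaf i0; have [in1 lo1] := node_start_leaf i1.
  have [_ s0] := leaf_node_start in0; have [_ s1] := leaf_node_start in1.
  have [l [r [sc sl sr]]] := caret_child cin.
  rewrite li node_start_rcons_false in lo0; rewrite li in s0; rewrite li1 in s1.
  by rewrite /node_end sc /= -sl -sr s0 s1 lo0 addn2.
rewrite !add0n => -[ic hc]; exists c => //.
have [l [r [sc sl sr]]] := caret_child cin.
have [l0 r0] := (nleaves_gt0 l, nleaves_gt0 r).
have [lL rL] : l = Leaf /\ r = Leaf.
  by move: hc; rewrite /node_end sc -ic /= => ?; split; apply: nleaves1; lia.
have [e0 _] := leaf_node_start (mem_leaves_child cin (etrans sl lL)).
have [e1 _] := leaf_node_start (mem_leaves_child cin (etrans sr rL)).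
rewrite node_start_rcons_false -ic in e0.
move: e1; rewrite -{1}cats1 node_start_cat sc /= lL -ic addn1 => ->.
by rewrite e0 !eqxx.
Qed.

(** * Reduced diagrams as pairs of forests *)

(** In a left subtree of a right caret, the leaf exponent is the number of left
    edges at the end of the address within that subtree. *)
Fixpoint trail (r : seq bool) : nat :=
  if r is false :: r' then (trail r').+1 else 0.

Lemma trail_rcons_false s : trail (rcons s false) = trail s + all negb s.
Proof. by elim: s => [|[] s IH] //=; rewrite IH. Qed.

Lemma trail_rcons_true s : trail (rcons s true) = trail s.
Proof. by elim: s => [|[] s IH] //=; rewrite IH. Qed.

Lemma up_left_length_rcons_true s :
  up_left_length (rcons s true) = up_left_length s.
Proof. by elim: s => [|[] s IH] //=; rewrite /on_right_side all_rcons IH. Qed.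

Lemma up_left_length_rcons_false s : up_left_length (rcons s false) = trail s.
Proof. by elim: s => [|[] s IH] //=; rewrite /on_right_side all_rcons IH. Qed.

Lemma leaf_Caret_l l r k : k < nleaves l -> leaf (Caret l r) k = false :: leaf l k.
Proof.
by move=> kl; rewrite /leaf /= nth_cat size_map size_leaves kl (nth_map [::]) ?size_leaves.
Qed.

Lemma leaf_Caret_r l r k : k < nleaves r ->
  leaf (Caret l r) (nleaves l + k) = true :: leaf r k.
Proof.
move=> kr; rewrite /leaf /= nth_cat size_map size_leaves ltnNge leq_addr /= addKn.
by rewrite (nth_map [::]) ?size_leaves.
Qed.

Lemma all_negb_leaf t k : k < nleaves t -> all negb (leaf t k) = (k == 0).
Proof.
move=> kt; apply/idP/eqP => [/(node_start_all_left t)|->]; first by rewrite (node_start_leaf kt).2.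
by elim: t {k kt} => //= l IHl r _; rewrite leaf_Caret_l ?nleaves_gt0.
Qed.

Local Open Scope group_scope.

Lemma prod_iota_Caret (F : nat -> ThompsonF) l r :
  \prod_(k <- iota 0 (nleaves (Caret l r))) F k =
  (\prod_(k <- iota 0 (nleaves l)) F k)
    * \prod_(k <- iota 0 (nleaves r)) F (nleaves l + k)%N.
Proof. by rewrite /= iotaD big_cat /= add0n -{2}[nleaves l]addn0 iotaDl big_map. Qed.

(** A caret adds one left edge to the path of its first leaf and none to the other
    paths. *)
Lemma prod_tree_elt o t :
  \prod_(k <- iota 0 (nleaves t)) xgen (o + k)%N ^+ trail (rev (leaf t k)) = tree_elt o t.
Proof.
elim: t o => [|l IHl r IHr] o; first by rewrite /= big_seq1.
rewrite prod_iota_Caret /= -IHr; congr (_ * _); last first.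
  apply: eq_big_seq => k; rewrite mem_iota => /andP[_ kr].
  by rewrite leaf_Caret_r // rev_cons trail_rcons_true addnA.
rewrite -IHl; have := nleaves_gt0 l; case E : (nleaves l) => [|m] // _.
rewrite /= !big_cons mulgA addn0; congr (_ * _).
  rewrite leaf_Caret_l ?nleaves_gt0 // rev_cons trail_rcons_false all_rev.
  by rewrite all_negb_leaf ?nleaves_gt0 // addn1 expgS.
apply: eq_big_seq => k; rewrite mem_iota => /andP[k0 km].
rewrite leaf_Caret_l ?E // rev_cons trail_rcons_false all_rev all_negb_leaf ?E //.
by case: k k0 km => // k _ _; rewrite addn0.
Qed.

Lemma prod_forest_elt o t :
  \prod_(k <- iota 0 (nleaves t)) xgen (o + k)%N ^+ leaf_exponent t k
  = forest_elt o (spine t).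
Proof.
elim: t o => [|l _ r IHr] o; first by rewrite /= big_seq1.
rewrite prod_iota_Caret /= -IHr -prod_tree_elt; congr (_ * _);
  apply: eq_big_seq => k; rewrite mem_iota => /andP[_ kl]; rewrite /leaf_exponent.
  by rewrite leaf_Caret_l // rev_cons up_left_length_rcons_false.
by rewrite leaf_Caret_r // rev_cons up_left_length_rcons_true addnA.
Qed.

Lemma prod_rev_inv (s : seq nat) (x : nat -> ThompsonF) (e : nat -> nat) :
  \prod_(k <- rev s) x k ^- e k = (\prod_(k <- s) x k ^+ e k)^-1.
Proof.
elim: s => [|k s IH]; first by rewrite !big_nil invg1.
by rewrite rev_cons -cats1 big_cat big_seq1 big_cons invgM IH.
Qed.

Lemma diagram_elementE d : is_diagram d ->
  diagram_element d = pair_elt (spine d.1) (spine d.2).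
Proof.
case/andP => _ /eqP sz; rewrite /diagram_element prod_rev_inv /pair_elt.
rewrite -!prod_forest_elt !nleaves_ncarets -sz.
by congr (_ * _^-1); apply: eq_bigr.
Qed.

Local Close Scope group_scope.

Lemma size_tree_arcs o t : size (tree_arcs o t) = ncarets t.
Proof.
by elim: t o => // l IHl r IHr o; rewrite ncarets_Caret /= size_cat IHl IHr.
Qed.

Lemma nonright_caretsE t : nonright_carets t = size (spine_arcs t).
Proof.
rewrite /spine_arcs; elim: t 0 => // l _ r IHr o; rewrite /nonright_carets /= count_cat size_cat.
rewrite size_tree_arcs /= !count_map -IHr; congr (_ + _).
Qed.

(** Either the last left subtree of the right side contains a caret, and its root
    ends at the last gap of the forest, or the lowest right caret has two
    leaves. *)
Lemma tree_arcs_end o t : t <> Leaf ->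
  (exists x, (x, o + ncarets t) \in forest_arcs o (spine t))
  \/ ((o + ncarets t).-1, (o + ncarets t).+1) \in tree_arcs o t.
Proof.
elim: t o => // l _ r IHr o _; rewrite ncarets_Caret.
case: r IHr => [|r1 r2] IHr.
  rewrite (erefl : ncarets Leaf = 0) addn0 -nleaves_ncarets /= cats0.
  case: l => [|l1 l2]; first by right; rewrite /= addn1 addn2 mem_seq1 eqxx.
  by left; exists o; apply: tree_arcs_full.
have := IHr (o + nleaves l); set r := Caret r1 r2.
have -> : o + nleaves l + ncarets r = o + (ncarets l + ncarets r).+1.
  by rewrite nleaves_ncarets; lia.
case=> [//|[x xr]|e]; first by left; exists x; rewrite [forest_arcs _ _]/= mem_cat xr orbT.
by right; rewrite [tree_arcs _ _]/= inE mem_cat e !orbT.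
Qed.

(** Otherwise the lowest right carets of both trees have two leaves and match. *)
Lemma reduced_end d : reduced d -> d = identity_diagram \/
  exists x, (x, ncarets d.1) \in spine_arcs d.1 \/ (x, ncarets d.1) \in spine_arcs d.2.
Proof.
case=> /andP[d0 /eqP sz] [->|red]; first by left.
right; apply: contrapT => none; apply: (red (ncarets d.1).-1).
have ne t : 0 < ncarets t -> t <> Leaf by move=> + e; rewrite e.
have eqS : (ncarets d.1).-1.+2 = (ncarets d.1).+1 by rewrite prednK.
rewrite !exposed_atE eqS; split.
  case: (tree_arcs_end 0 (ne _ d0)) => // -[x xt]; case: none; exists x; left.
  exact: xt.
have d20 : 0 < ncarets d.2 by rewrite -sz.
case: (tree_arcs_end 0 (ne _ d20)); rewrite !add0n -sz // => -[x xt].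
by case: none; exists x; right.
Qed.

Lemma penalty_caretE d p : reduced d ->
  penalty_caret d p = penalty (spine_arcs d.1) (spine_arcs d.2) p.
Proof.
move=> red; have [/andP[_ /eqP sz] _] := red.
have is2 : is_caret d.2 p = is_caret d.1 p by rewrite /is_caret -sz.
have arc_le x y : (x, y) \in spine_arcs d.1 \/ (x, y) \in spine_arcs d.2 -> x.+2 <= y <= ncarets d.1.
  move=> [] xy; have [_ ?] := forest_arcs_bounds xy; move: xy; rewrite spine_arcsE -?sz; lia.
rewrite /penalty_caret !type_NE !right_caretE is2; apply/idP/idP.
  case/or3P => [/andP[p0 st]|/andP[p0 st]|/and3P[/andP[pin e1] /andP[_ e2] pN]].
  - by apply: (penaltyP p0); rewrite st; left.
  - by apply: (penaltyP p0); rewrite st orbT; left.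
  have p0 : 0 < p by case/andP: pin.
  apply: (penaltyP p0); case: (reduced_end red) => [e|[x xN]].
    by move: pin pN; rewrite e /is_caret /ncarets /=; lia.
  have := arc_le _ _ xN => xN'.
  have px : p <= x.
    rewrite leqNgt; apply/negP => xp; have pN' : p < ncarets d.1 by case/andP: pin; lia.
    by case: xN => xN; [move/exposedP: e1 | move/exposedP: e2] => /(_ _ _ xN xp pN').
  have stx : starts (spine_arcs d.1) x || starts (spine_arcs d.2) x.
    by case: xN => xN; apply/orP; [left|right]; apply/startsP; exists (ncarets d.1).
  move: px; rewrite leq_eqVlt => /orP[/eqP->|px]; first by left.
  by right; split=> //; exists x.
move=> pp; have p0 := penalty_gt0 pp; rewrite p0 /=.
case/penalty_cases: pp => [/orP[->|->]|[-> -> [z pz st]]]; rewrite ?orbT //.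
have [w zw] : exists w, (z, w) \in spine_arcs d.1 \/ (z, w) \in spine_arcs d.2.
  by case/orP: st => /startsP[w zw]; exists w; [left|right].
have := arc_le _ _ zw => zw'.
have pin : is_caret d.1 p by rewrite /is_caret; lia.
have pN : p != ncarets d.1 by lia.
by rewrite pin pN !orbT.
Qed.

Lemma reduced_no_common_ear d : reduced d -> no_common_ear (spine d.1) (spine d.2).
Proof.
move=> [_ [->|red]] x; first by rewrite -/(spine_arcs _).
rewrite -!/(spine_arcs _) !spine_arcsE => /andP[x1 _] /andP[x2 _].
by apply: (red x); rewrite !exposed_atE.
Qed.

Lemma adjacentE d p q : is_diagram d -> adjacent d p q =
  is_caret d.1 q && adj (spine_arcs d.1) (spine_arcs d.2) p q.
Proof.
move=> /andP[_ /eqP sz].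
have is2 k : is_caret d.2 k = is_caret d.1 k by rewrite /is_caret -sz.
rewrite /adjacent; case: eqP => [->|/eqP p0].
  by rewrite !left_caret_edge is2 -andb_orr.
have [qin|] := boolP (is_caret d.1 q); last by rewrite andbF.
rewrite /=; have [pin|npin] := boolP (is_caret d.1 p).
  rewrite !adjacent_in_edge ?is2 //= -/(adj _ _ p q) andb_idl // => /adj_lt; apply.
    exact: forest_arcs_wf.
  exact: forest_arcs_wf.
symmetry; apply/negP => /(adj_lt (@forest_arcs_wf 0 _) (@forest_arcs_wf 0 _)) pq.
by move: npin qin; rewrite /is_caret; lia.
Qed.

Lemma strip_leaves f : exists g k, f = g ++ nseq k Leaf /\
  (g = [::] \/ exists g' l r, g = rcons g' (Caret l r)).
Proof.
elim/last_ind: f => [|f [|l r] [g [k [-> gP]]]].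
- by exists [::], 0; split=> //; left.
- exists g, k.+1; split=> //; rewrite -cats1 -catA; congr (_ ++ _).
  by elim: (k) => //= m ->.
- exists (rcons (g ++ nseq k Leaf) (Caret l r)), 0; rewrite cats0; split=> //; right.
  by exists (g ++ nseq k Leaf), l, r.
Qed.

Lemma ncarets_unspine f : ncarets (unspine f) = bound f (size f).
Proof.
elim: f => // t f IH; rewrite /unspine [foldr _ _ _]/= ncarets_Caret -/(unspine f) IH.
by rewrite [size _]/= bound_cons nleaves_ncarets.
Qed.

Lemma bound_nseq k i : bound (nseq k Leaf) i = i.
Proof.
by elim: i => // i IH; rewrite boundS IH nth_nseq if_same addn1.
Qed.

Lemma tree_arcs_unspine_end f l r :
  let t := unspine (rcons f (Caret l r)) in
  ((ncarets t).-1, (ncarets t).+1) \in tree_arcs 0 t -> False.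
Proof.
move=> t last_arc; set g := rcons f (Caret l r) in t last_arc.
have g_last : nth Leaf g (size f) = Caret l r by rewrite nth_rcons ltnn eqxx.
have := @bound_arc 0 g (size f); rewrite g_last !add0n => /(_ ltac:(by [])).
rewrite -[g]unspineK -/t -/(spine_arcs t) unspineK.
have <- : ncarets t = bound g (size f).+1.
  by rewrite /t ncarets_unspine size_rcons.
rewrite spine_arcsE leqnn andbT => xN.
have [_ ? _] := tree_arcs_bounds xN.
by have := tree_arcs_noncrossing xN last_arc; lia.
Qed.

(** Leaves at the end of both forests come from matching right carets.  After they
    are dropped, the forest with fewer leaves is padded to the size of the other;
    the longer one ends with a caret, so that no pair of right carets matches. *)
Lemma reduced_diagram_of A B : no_common_ear A B ->
  exists d, [/\ reduced d, spine_arcs d.1 = forest_arcs 0 A, spine_arcs d.2 = forest_arcs 0 B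
    & diagram_element d = pair_elt A B].
Proof.
have [g [k [eA gP]]] := strip_leaves A; have [h [m [eB hP]]] := strip_leaves B.
rewrite /pair_elt eA eB /no_common_ear !forest_arcs_cat_nseq !forest_elt_cat_nseq => red.
pose w f := ncarets (unspine f).
have w_pad f j : w (f ++ nseq j Leaf) = w f + j.
  by rewrite /w !ncarets_unspine size_cat size_nseq boundD bound_cat_nseq drop_size_cat // bound_nseq.
pose N := maxn (w g) (w h).
have [N0|N0] := posnP N.
  have nil f : f = [::] \/ (exists f' l r, f = rcons f' (Caret l r)) -> w f = 0 -> f = [::].
    case=> // -[f' [l [r ->]]]; rewrite /w ncarets_unspine size_rcons boundS nth_rcons ltnn eqxx.
    by have := nleaves_gt0 (Caret l r); lia.
  have -> : g = [::] by apply: nil => //; lia.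
  have -> : h = [::] by apply: nil => //; lia.
  exists identity_diagram; split=> //; first by split=> //; left.
  by rewrite diagram_elementE // /pair_elt /= !mulg1.
pose g' := g ++ nseq (N - w g) Leaf; pose h' := h ++ nseq (N - w h) Leaf.
have wg : ncarets (unspine g') = N by rewrite -/(w g') w_pad subnKC // leq_maxl.
have wh : ncarets (unspine h') = N by rewrite -/(w h') w_pad subnKC // leq_maxr.
have dP : is_diagram (unspine g', unspine h') by rewrite /is_diagram /= wg wh N0 eqxx.
have ag : spine_arcs (unspine g') = forest_arcs 0 g by rewrite /spine_arcs unspineK forest_arcs_cat_nseq.
have ah : spine_arcs (unspine h') = forest_arcs 0 h by rewrite /spine_arcs unspineK forest_arcs_cat_nseq.
exists (unspine g', unspine h'); split=> //; last first.
  by rewrite diagram_elementE //= /pair_elt !unspineK !forest_elt_cat_nseq.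
split=> //; right=> i; rewrite !exposed_atE /= => -[ig ih].
have [iN|iN] := leqP i.+2 N.
  by apply: (red i); rewrite -?ag -?ah spine_arcsE ?ig ?ih ?wg ?wh.
have eN : i = N.-1.
  have [_ _] := tree_arcs_bounds ig; rewrite nleaves_ncarets wg; lia.
have bad f : f = [::] \/ (exists f' l r, f = rcons f' (Caret l r)) ->
    w f = N -> (i, i.+2) \in tree_arcs 0 (unspine (f ++ nseq (N - w f) Leaf)) -> False.
  move=> fP wf; rewrite wf subnn cats0; case: fP => [f0|[f' [l [r ef]]]].
    by move: N0; rewrite -wf f0.
  have -> : i.+2 = N.+1 by lia.
  by rewrite eN -wf ef; apply: tree_arcs_unspine_end.
have [gN|hN] : w g = N \/ w h = N by rewrite /N; lia.
  exact: bad gP gN ig.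
exact: bad hP hN ih.
Qed.

(** * Penalty trees as parent maps *)

Lemma leastP (P : nat -> Prop) : (exists k, P k) ->
  P (least P) /\ forall k, P k -> least P <= k.
Proof.
move=> [k0 Pk0]; rewrite /least; case: pselect => [ex|nex]; last first.
  by case: nex; exists k0; apply/asboolP.
by case: ex_minnP => k /asboolP Pk min; split=> // j /asboolP /min.
Qed.

Section PenaltyTrees.
Variables (n : nat) (d : diagram).
Hypothesis red : reduced d.

Local Notation N := (ncarets d.1).
Local Notation a := (spine_arcs d.1).
Local Notation b := (spine_arcs d.2).
Local Notation V := 'I_N.+1.
Local Notation arc := Defs.arc.

Let dP : is_diagram d. Proof. by case: red. Qed.

Lemma adjacent_lt p q : adjacent d p q -> p < q <= N.
Proof.
rewrite adjacentE // => /andP[/andP[_ qN] /adj_lt pq]; rewrite qN andbT; apply: pq.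
  exact: forest_arcs_wf.
exact: forest_arcs_wf.
Qed.

Lemma penalty_ncarets p : penalty a b p -> p <= N.
Proof.
by rewrite -penalty_caretE // => /or3P[/and4P[/andP[]]|/and4P[/andP[_ +]]|/andP[/andP[/andP[]]]] //;
  case/andP: dP => _ /eqP->.
Qed.

Lemma dpath_rcons (P : caret_digraph d) p q v s : dpath P p q s -> arc P q v -> dpath P p v (rcons s v).
Proof. by case=> ps <- qv; rewrite /dpath rcons_path last_rcons ps qv. Qed.

Lemma dpath_rconsP (P : caret_digraph d) p v s : dpath P p v s -> p != v ->
  exists s' q, [/\ s = rcons s' v, dpath P p q s' & arc P q v].
Proof.
case/lastP: s => [[_ /= ->]|s v' [+ +]]; first by rewrite eqxx.
rewrite rcons_path last_rcons => /andP[ps pv] <- _.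
by exists s, (last p s).
Qed.

(** Vertices outside the tree get their predecessor as parent, to which they are
    always adjacent. *)
Lemma penalty_tree_parent_map (P : caret_digraph d) : penalty_tree P ->
  pair_weight_le n a b (tree_penalty_weight n P).
Proof.
case=> -[r0 ends uniq_path] adjP penV leafP.
pose parent (v : V) := [pick p | arc P p v].
pose par y := if insub y is Some v then
    (if parent v is Some p then val p else y.-1) else y.-1.
have arc_lt (p q : V) : arc P p q -> p < q by move=> /adjP/adjacent_lt/andP[].
have parE (p q : V) : arc P p q -> par q = p.
  move=> pq; rewrite /par valK /parent; case: pickP => [p' p'q|/(_ p)]; last by rewrite pq.
  have [[pV qV] [p'V _]] := (ends _ _ pq, ends _ _ p'q).
  have [s [sp _]] := uniq_path p pV; have [s' [sp' _]] := uniq_path p' p'V.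
  have [t [_ ut]] := uniq_path q qV.
  have := ut _ (dpath_rcons sp' p'q); rewrite (ut _ (dpath_rcons sp pq)).
  by move=> /rcons_inj[ess]; case: sp sp' => _ <- [_ <-]; rewrite ess.
have has_parent (v : V) : v \in verts P -> v != ord0 -> exists2 p, p \in verts P & arc P p v.
  move=> vV v0; have [s [sv _]] := uniq_path v vV.
  have [|s' [p [_ _ pv]]] := dpath_rconsP sv; first by rewrite eq_sym.
  by exists p => //; case: (ends _ _ pv).
have par0 : par 0 = 0.
  rewrite /par; case: insubP => //= v _ v0; rewrite /parent; case: pickP => //= p /arc_lt.
  by rewrite v0.
have pm : parent_map a b par.
  split=> // y y0; rewrite /par; have triv : adj a b y.-1 y by rewrite /adj /edge prednK ?eqxx.
  case: insubP => [v _ vy|_ //]; rewrite /parent; case: pickP => [p /adjP|_ //].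
  by rewrite adjacentE // -vy => /andP[].
exists par => //.
exists [seq val v | v <- enum [pred v | `[< weighted n P v >]]].
  by rewrite size_map -cardE.
move=> w [[p pp [m nm mw]] nz].
pose pv : V := inord p; have pvE : val pv = p by rewrite /= inordK // ltnS penalty_ncarets.
have pV : pv \in verts P by apply: penV; rewrite penalty_caretE // -/(val pv) pvE.
have ancestor j : iter j par p <> 0 -> exists u : V,
    [/\ val u = iter j par p, u \in verts P & exists2 s, dpath P u pv s & size s = j].
  elim: j => [_|j IH nzj]; first by exists pv; split=> //; exists [::].
  have [|u [uE uV [s us sj]]] := IH; first by move=> e; apply: nzj; rewrite /= e.
  have [|q qV qu] := has_parent u uV.
    by apply/eqP => u0; apply: nzj; rewrite /= -uE u0 par0.
  exists q; split=> //; first by rewrite /= -uE (parE _ _ qu).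
  by exists (u :: s); rewrite /= ?sj //; case: us => us ul; split; rewrite //= qu.
have wnz : w <> 0 by move=> w0; apply: nz; rewrite w0.
have [|u [uE uV [s us sm]]] := ancestor m; first by rewrite mw.
rewrite mw in uE; rewrite -uE map_f // mem_enum inE; apply/asboolP; split=> //.
  have [|q qV qu] := has_parent u uV; first by apply/eqP => u0; apply: wnz; rewrite -uE u0.
  have [|q' q'V q'q] := has_parent q qV.
    by apply/eqP => q0; apply: nz; rewrite -uE (parE _ _ qu) q0.
  have [t [tq' _]] := uniq_path q' q'V.
  exists (rcons (rcons t q) u); last by rewrite !size_rcons.
  exact: dpath_rcons (dpath_rcons tq' q'q) qu.
have leaf_below (v : V) : v \in verts P -> exists2 l, tree_leaf P l & exists s, dpath P v l s.
  move: {2}(N - v) (erefl (N - v)) => c; elim/ltn_ind: c v => c IH v cv vV.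
  have [noarc|] := pselect (forall q, ~~ arc P v q); first by exists v => //; exists [::].
  move=> some; have [q vq] : exists q, arc P v q.
    by apply: contrapT => none; apply: some => q; apply/negP => vq; apply: none; exists q.
  have vq' := arc_lt _ _ vq; have := ltn_ord q; rewrite ltnS => qN.
  have [|l ll [s' ql]] := IH (N - q) _ q erefl (ends _ _ vq).2; first by lia.
  by exists l => //; exists (q :: s'); case: ql => ql qll; split; rewrite //= vq.
have [l ll [s' pl]] := leaf_below pv pV; exists l => //; exists (s ++ s').
  by case: us pl => us ul [pl pll]; split; rewrite ?cat_path ?last_cat ul ?us.
by rewrite size_cat sm subn1 (leq_trans nm) // leq_addr.
Qed.

(** The tree spanned by the paths from the penalty vertices to 0: its leaves are
    penalty vertices by construction. *)
Lemma parent_map_penalty_tree k : pair_weight_le n a b k ->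
  exists2 P : caret_digraph d, penalty_tree P & tree_penalty_weight n P <= k.
Proof.
case=> par pm [s sk sP]; have [par0 pmE] := pm.
have par_lt := parent_lt (@forest_arcs_wf 0 (spine d.1)) (@forest_arcs_wf 0 (spine d.2)) pm.
pose inV y := y = 0 \/ height_ge (penalty a b) par y 0.
have par_le y : par y <= y by case: (posnP y) => [->|/par_lt/ltnW]; rewrite ?par0.
have inV_par y : inV y -> inV (par y).
  by case=> [->|/height_ge_step/(height_ge_le (leq0n _)) ry]; [left | right].
have inV_le y : inV y -> y <= N.
  case=> [-> //|[p /penalty_ncarets pN [m _ <-]]]; apply: leq_trans pN.
  by elim: m => //= m; apply: leq_trans.
pose P : caret_digraph d := Digraph [set v : V | `[< inV v >]]%SET
   (fun p q : V => [&& val q != 0, `[< inV q >] & par q == p]).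
have vertsP (v : V) : reflect (inV v) (v \in verts P) by rewrite inE; apply: asboolP.
have arcP (p q : V) : reflect [/\ val q <> 0, inV q & par q = p] (arc P p q).
  by apply: (iffP and3P) => [[/eqP ? /asboolP ? /eqP ?]|[/eqP ? /asboolP ? /eqP ?]].
have parent (v : V) : inV v -> val v <> 0 -> exists2 p : V, inV p & arc P p v /\ p < v.
  move=> vV v0; have pvN : par v < N.+1 by rewrite ltnS inV_le //; apply: inV_par.
  exists (Ordinal pvN); first exact: inV_par.
  by split; [apply/arcP | apply: par_lt; rewrite lt0n; apply/eqP].
have child (l : V) y : inV y -> y <> 0 -> par y = l -> exists2 q : V, val q = y & arc P l q.
  move=> yV y0 yl; have yN : y < N.+1 by rewrite ltnS inV_le.
  by exists (Ordinal yN) => //; apply/arcP.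
have iterP (u v : V) t : dpath P u v t -> iter (size t) par v = u.
  elim/last_ind: t v => [v [_ /= ->] //|t w IH v [+ +]].
  rewrite rcons_path last_rcons size_rcons iterSr => /andP[pt /arcP[_ _ e]] <-.
  by rewrite e; apply: IH.
exists P.
  split; first split.
  - by apply/vertsP; left.
  - move=> p q /arcP[q0 qV pq]; split; apply/vertsP => //.
    by rewrite -pq; apply: inV_par.
  - move=> v /vertsP; move: {2}(val v) (erefl (val v)) => c.
    elim/ltn_ind: c v => c IH v cv vV.
    have [v0|/eqP v0] := eqVneq (val v) 0.
      have -> : v = ord0 by apply: val_inj.
      exists [::]; split=> // t; case/lastP: t => // t w [+ +].
      by rewrite rcons_path last_rcons => /andP[_ /arcP[w0 _ _]] e; rewrite e in w0.
    have [p pV [pv plt]] := parent v vV v0.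
    have [|t [pt ut]] := IH (val p) _ p erefl pV; first by rewrite -cv.
    exists (rcons t v); split; first exact: dpath_rcons pt pv.
    move=> t' t'v; have [|t'' [q [-> t''q qv]]] := dpath_rconsP t'v.
      by apply/eqP => e; apply: v0; rewrite -e.
    have qp : q = p by apply: val_inj; case/arcP: qv => _ _ /= <-; case/arcP: pv.
    by rewrite (ut t'') -?qp.
  - move=> p q /arcP[q0 _ pq]; rewrite adjacentE // /is_caret lt0n (introF eqP q0) /=.
    by rewrite -ltnS ltn_ord /= -pq; apply: pmE; rewrite lt0n; apply/eqP.
  - move=> p; rewrite penalty_caretE // => pp; apply/vertsP; right; exact: height_ge_penalty.
  have [[p0 pp0]|none] := pselect (exists p, penalty a b p); last first.
    left; apply/setP => v; rewrite inE in_set1; apply/asboolP/eqP => [|->]; last by left.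
    case=> [v0|[p pp _]]; first exact: val_inj.
    by case: none; exists p.
  right=> l [/vertsP lV lleaf]; rewrite penalty_caretE //.
  have nochild y : inV y -> y <> 0 -> par y = l -> False.
    move=> yV y0 yl; have [q _ lq] := child l y yV y0 yl.
    by have := lleaf q; rewrite lq.
  case: lV => [l0|[p pp [[|m] _ pl]]].
  - have p0V : inV p0 by right; apply: height_ge_penalty.
    have [y yV /andP[py y0]] := path_crosses par0 par_lt inV_par p0V (penalty_gt0 pp0).
    by case: (nochild y yV); [lia | rewrite l0; lia].
  - by rewrite -pl.
  - case: (nochild (iter m par p)) => //; first by right; exists p => //; exists m.
    move=> e; have l0 : val l = 0 by move: pl; rewrite /= e par0 => <-.
    have p0V : inV p by right; apply: height_ge_penalty.
    have [y yV /andP[py y0]] := path_crosses par0 par_lt inV_par p0V (penalty_gt0 pp).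
    by apply: (nochild y yV); [lia | rewrite -/(val l) l0; lia].
apply: leq_trans sk; rewrite /tree_penalty_weight cardE -(size_map val).
apply: uniq_leq_size; first by rewrite (map_inj_uniq val_inj) enum_uniq.
move=> _ /mapP[v + ->]; rewrite mem_enum inE => /asboolP[/vertsP vV [t tv t2] [l ll [t' vl nt']]].
apply: sP; have v0 : val v <> 0.
  case/lastP: t tv t2 => [//|t w [+ +]] _.
  by rewrite rcons_path last_rcons => /andP[_ /arcP[w0 _ _]] <-.
split.
  have lV : height_ge (penalty a b) par l 0.
    case: ll => /vertsP[l0|//] _; case: v0; rewrite -[val v](iterP _ _ _ vl) l0.
    by elim: (size t') => //= j ->.
  have := height_ge_iter (size t') lV; rewrite (iterP _ _ _ vl); apply: height_ge_le.
  by rewrite addn0 -subn1.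
have [|t1 [q [et tq qv]]] := dpath_rconsP tv; first by apply/eqP => e; apply: v0; rewrite -e.
have [_ _ ->] := arcP _ _ qv.
rewrite et size_rcons in t2; case/lastP: t1 t2 {et} tq => // t1 w _ [+ +].
by rewrite rcons_path last_rcons => /andP[_ /arcP[w0 _ _]] <-.
Qed.

Lemma exists_pair_weight : exists k, pair_weight_le n a b k.
Proof.
have [M penM] := penalty_bounded a b; exists M.+1, predn.
  by split=> // y y0; rewrite /adj /edge prednK ?eqxx.
exists (iota 0 M.+1); rewrite ?size_iota // => w [[p /penM pM [m _ <-]] _].
rewrite mem_iota /= add0n ltnS; apply: leq_trans pM.
by elim: m => //= m; apply: leq_trans; apply: leq_pred.
Qed.

Lemma diagram_penalty_weightP :
  pair_weight_le n a b (diagram_penalty_weight n d) /\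
  forall k, pair_weight_le n a b k -> diagram_penalty_weight n d <= k.
Proof.
have [k0 /parent_map_penalty_tree[P0 P0t _]] := exists_pair_weight.
have [|[P [Pt eP]] min] := leastP (P := fun k => exists P : caret_digraph d,
    penalty_tree P /\ tree_penalty_weight n P = k); first by exists (tree_penalty_weight n P0), P0.
split; first by rewrite /diagram_penalty_weight -eP; apply: penalty_tree_parent_map.
move=> k /parent_map_penalty_tree[Q Qt Qk]; apply: leq_trans Qk.
by apply: min; exists Q.
Qed.

End PenaltyTrees.

(** * Positive words in F *)

(** F acts on forests of complete binary trees.  A point is a pair of the number of
    a tree and a path in it that turns left from some step on, encoded by the
    natural number with these binary digits: [odd] reads the first step and [half]
    drops it.  The generator [xgen i]
    removes the root of the tree [i] and turns its two children into trees. *)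
Definition descend (i : nat) (p : nat * nat) : nat * nat :=
  if p.1 < i then p else if p.1 == i then (i + odd p.2, p.2./2) else (p.1.+1, p.2).

Definition ascend (i : nat) (p : nat * nat) : nat * nat :=
  if p.1 < i then p else if p.1 == i then (i, p.2.*2)
  else if p.1 == i.+1 then (i, p.2.*2.+1) else (p.1.-1, p.2).

Lemma descendK i : cancel (descend i) (ascend i).
Proof.
move=> [j s]; rewrite /descend /=; do 2?case: ifP => ? /=; rewrite /ascend /=;
  do 3?case: ifP => ? /=; try lia; congr pair; lia.
Qed.

Lemma ascendK i : cancel (ascend i) (descend i).
Proof.
move=> [j s]; rewrite /ascend /=; do 3?case: ifP => ? /=; rewrite /descend /=;
  do 2?case: ifP => ? /=; try lia; congr pair; lia.
Qed.

Lemma descend_swap i j p : i < j -> descend i (descend j p) = descend j.+1 (descend i p).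
Proof.
case: p => m s ij; rewrite {2 4}/descend /=.
do 4?case: ifP => ? /=; rewrite /descend /=;
  do 4?case: ifP => ? /=; try lia; congr pair; lia.
Qed.

Definition act_letter (p : nat * nat) (x : letter) : nat * nat :=
  if x.2 then ascend x.1 p else descend x.1 p.

Lemma word_cong_act u v : word_cong u v ->
  forall p, foldl act_letter p u = foldl act_letter p v.
Proof.
elim=> {u v} [//|u v _ IH p|u v w _ IH1 _ IH2 p|u u' v v' _ IH1 _ IH2 p|i b p|i j ij p].
- by rewrite IH.
- by rewrite IH1.
- by rewrite !foldl_cat IH1 IH2.
- by case: b; rewrite /= /act_letter /= ?ascendK ?descendK.
- by rewrite /= /act_letter /= descend_swap // ascendK.
Qed.

Local Open Scope group_scope.

Lemma prod_xgen_pi (s : seq nat) :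
  \prod_(i <- s) xgen i = (\pi_ThompsonF [seq (i, false) | i <- s])%qT.
Proof.
elim: s => [|i s IH]; first by rewrite big_nil.
by rewrite big_cons IH /xgen; apply: (Fmul_pi [:: (i, false)]).
Qed.

Lemma prod_xgen_act (s t : seq nat) : \prod_(i <- s) xgen i = \prod_(i <- t) xgen i ->
  forall p, foldl (fun p i => descend i p) p s = foldl (fun p i => descend i p) p t.
Proof.
rewrite !prod_xgen_pi => /ThompsonF_eqP/word_cong_act st p.
have E r q : foldl (fun p i => descend i p) q r
    = foldl act_letter q [seq (i, false) | i <- r] by elim: r q => //= i r IH q.
by rewrite !E st.
Qed.

Lemma foldl_descend_ge s p : p.1 <= (foldl (fun p i => descend i p) p s).1.
Proof.
elim: s p => //= i s IH p; apply: leq_trans (IH _).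
by rewrite /descend; case: ifP => // _; case: eqP => [->|_] /=; lia.
Qed.

Lemma foldl_descend_id s p : all (ltn p.1) s -> foldl (fun p i => descend i p) p s = p.
Proof. by elim: s => //= i s IH /andP[pi /IH sp]; rewrite {2}/descend pi. Qed.

(** The point [(k, 1)], the right child of the tree [k], is fixed by the generators
    above [k] and moved to a later tree by a positive word that starts with
    [xgen k]. *)
Lemma prod_xgen_neq k s t : all (ltn k) t ->
  \prod_(i <- k :: s) xgen i <> \prod_(i <- t) xgen i.
Proof.
move=> kt /prod_xgen_act/(_ (k, 1%N)); rewrite [RHS]foldl_descend_id //= => e.
have := foldl_descend_ge s (descend k (k, 1%N)); rewrite e /descend /= ltnn eqxx /=; lia.
Qed.

(** Uniqueness of positive normal forms. *)
Lemma sorted_prod_xgen_inj (s t : seq nat) : pairwise leq s -> pairwise leq t ->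
  \prod_(i <- s) xgen i = \prod_(i <- t) xgen i -> s = t.
Proof.
have above i j t' : i < j -> pairwise leq (j :: t') -> all (ltn i) (j :: t').
  move=> ij /= /andP[/allP jt _]; rewrite ij /=; apply/allP => x /jt.
  exact: leq_trans.
elim: s t => [|i s IH] [|j t] //.
- by move=> _ _ /esym/prod_xgen_neq; case.
- by move=> _ _ /prod_xgen_neq; case.
move=> ps pt e; case: (ltngtP i j) => [ij|ji|ij].
- by case: (prod_xgen_neq (above _ _ _ ij pt) e).
- by case: (prod_xgen_neq (above _ _ _ ji ps) (esym e)).
rewrite ij in ps e *; congr (_ :: _); apply: IH.
- by case/andP: ps.
- by case/andP: pt.
by move: e; rewrite !big_cons => /mulgI.
Qed.

Lemma tree_elt_arcs o t : tree_elt o t = \prod_(e <- tree_arcs o t) xgen e.1.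
Proof.
elim: t o => [|l IHl r IHr] o /=; first by rewrite big_nil.
by rewrite big_cons big_cat IHl IHr /= mulgA.
Qed.

Lemma forest_elt_arcs o f : forest_elt o f = \prod_(e <- forest_arcs o f) xgen e.1.
Proof.
elim: f o => [|t f IH] o /=; first by rewrite big_nil.
by rewrite big_cat tree_elt_arcs IH.
Qed.

Local Close Scope group_scope.

Lemma pairwise_tree_arcs o t : pairwise leq [seq e.1 | e <- tree_arcs o t].
Proof.
elim: t o => //= l IHl r IHr o; rewrite all_map map_cat pairwise_cat IHl IHr !andbT.
apply/andP; split.
  apply/allP => -[x y]; rewrite mem_cat /= => /orP[] /tree_arcs_bounds[]; lia.
apply/allrelP => _ _ /mapP[[x y] xy ->] /mapP[[z w] zw ->] /=.
by have := tree_arcs_bounds xy; have := tree_arcs_bounds zw; case=> ? _ _ []; lia.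
Qed.

Lemma pairwise_forest_arcs o f : pairwise leq [seq e.1 | e <- forest_arcs o f].
Proof.
elim: f o => //= t f IH o; rewrite map_cat pairwise_cat IH pairwise_tree_arcs !andbT.
apply/allrelP => _ _ /mapP[[x y] xy ->] /mapP[[z w] zw ->] /=.
by have := tree_arcs_bounds xy; have := forest_arcs_bounds zw; case=> ? _ []; lia.
Qed.

(** The arcs of a forest, read from left to right, give the positive normal form of
    its element.  So the two forests have the same starts of arcs, and at the last
    start both have an ear. *)
Lemma trivial_pair A B : no_common_ear A B -> pair_elt A B = 1%g -> narcs A B = 0.
Proof.
move=> red AB1; have eBA : forest_elt 0 B = forest_elt 0 A.
  by rewrite -[RHS]mul1g -AB1 /pair_elt mulgVK.
rewrite !forest_elt_arcs -!(big_map fst xpredT xgen) in eBA.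
have {eBA} eq_starts := sorted_prod_xgen_inj (pairwise_forest_arcs 0 B)
  (pairwise_forest_arcs 0 A) eBA.
have mem_starts f x : starts (forest_arcs 0 f) x = (x \in [seq e.1 | e <- forest_arcs 0 f]).
  apply/startsP/mapP => [[y xy]|[[x' y] xy ->]]; last by exists y.
  by exists (x, y).
apply/eqP; rewrite /narcs -!(size_map fst) eq_starts addnn double_eq0.
rewrite size_eq0; apply: contraT => nonempty; exfalso.
have [k kA kmax] : exists2 k, k \in [seq e.1 | e <- forest_arcs 0 A] &
    forall x, x \in [seq e.1 | e <- forest_arcs 0 A] -> x <= k.
  exists (last 0 [seq e.1 | e <- forest_arcs 0 A]).
    by case: [seq _ | _ <- _] nonempty => //= x s _; apply: mem_last.
  move: (pairwise_forest_arcs 0 A); case/lastP: [seq _ | _ <- _] nonempty => // s x _.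
  rewrite last_rcons pairwise_rcons => /andP[/allP sx _] y.
  by rewrite mem_rcons inE => /orP[/eqP->|/sx].
have ear f : [seq e.1 | e <- forest_arcs 0 f] = [seq e.1 | e <- forest_arcs 0 A] ->
    (k, k.+2) \in forest_arcs 0 f.
  move=> ef; have : starts (forest_arcs 0 f) k by rewrite mem_starts ef.
  case/startsP => y /forest_arc_ear[//|]; rewrite mem_starts ef => /kmax.
  by rewrite ltnn.
exact: red (ear A erefl) (ear B eq_starts).
Qed.

(** * Word length *)

Section Letters.
Variable n : nat.

Definition is_gen (y : ThompsonF) : Prop := Xgens n y \/ Xgens n (y^-1)%g.

Lemma is_gen_letter y : is_gen y -> exists i e, i <= n /\ y = letter_elt i e.
Proof.
case=> [[i i_n ->]|[i i_n e]]; first by exists i, false.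
by exists i, true; split; rewrite // /letter_elt -e invgK.
Qed.

Lemma letter_is_gen i e : i <= n -> is_gen (letter_elt i e).
Proof. by case: e => i_n; [right | left]; exists i; rewrite /letter_elt ?invgK. Qed.

Lemma is_genV y : is_gen y -> is_gen (y^-1)%g.
Proof. by case=> H; [right | left]; rewrite ?invgK. Qed.

Lemma length_path A B (s : seq ThompsonF) : no_common_ear A B ->
    (forall y, y \in s -> is_gen y) ->
  exists A' B', [/\ no_common_ear A' B',
    (pair_elt A' B' = pair_elt A B * \prod_(y <- s) y)%g
    & forall k', pair_weight_le n (forest_arcs 0 A') (forest_arcs 0 B') k' ->
      exists2 k, pair_weight_le n (forest_arcs 0 A) (forest_arcs 0 B) k
        & narcs A B + k.*2 <= narcs A' B' + k'.*2 + size s].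
Proof.
elim: s A B => [|y s IH] A B red gens.
  by exists A, B; split=> // [|k pw]; [rewrite big_nil mulg1 | exists k; rewrite ?addn0].
have [i [e [i_n ey]]] := is_gen_letter (gens y (mem_head _ _)).
have [A1 [B1 [red1 e1 w1]]] := length_step e i_n red.
have [|A' [B' [red' e' w']]] := IH A1 B1 red1.
  by move=> z zs; apply: gens; rewrite inE zs orbT.
exists A', B'; split=> //; first by rewrite e' e1 big_cons -ey mulgA.
move=> k' /w'[k1 /w1[k pw le1] le']; exists k => //=; lia.
Qed.

Lemma length_le A B k : 0 < n -> no_common_ear A B ->
    pair_weight_le n (forest_arcs 0 A) (forest_arcs 0 B) k ->
  exists s : seq ThompsonF, [/\ size s <= narcs A B + k.*2,
    forall y, y \in s -> is_gen y & (\prod_(y <- s) y)%g = pair_elt A B].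
Proof.
move=> n0; move: {2}(_ + _) (erefl (narcs A B + k.*2)) => m.
elim/ltn_ind: m A B k => m IH A B k em red pw.
have [z|pos] := posnP (narcs A B).
  exists [::]; split=> //; rewrite big_nil /pair_elt !forest_elt_arcs.
  move/eqP: z; rewrite /narcs addn_eq0 !size_eq0 => /andP[/eqP-> /eqP->].
  by rewrite !big_nil mulgV.
have [i [e [A' [B' [k' [i_n [red' pw' e' lt]]]]]]] := length_descent n0 pos red pw.
have [|s [sz gens es]] := IH (narcs A' B' + k'.*2) _ A' B' k' erefl red' pw'.
  by rewrite -em.
exists (rcons s (letter_elt i e)^-1%g); split.
- by rewrite size_rcons; apply: leq_ltn_trans sz lt.
- move=> y; rewrite mem_rcons inE => /orP[/eqP->|/gens//].
  exact/is_genV/letter_is_gen.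
- by rewrite -cats1 big_cat big_seq1 es e' /= mulgK.
Qed.

End Letters.

Lemma exists_reduced_diagram g : exists d, reduced d /\ diagram_element d = g.
Proof.
have [u ->] := ThompsonF_surj g.
pose n := \max_(x <- u) x.1; pose s := [seq letter_elt x.1 x.2 | x <- u].
have es : (\prod_(y <- s) y)%g = (\pi_ThompsonF u)%qT.
  rewrite /s big_map {s n}; elim: u => [|[i e] u IH]; first by rewrite big_nil.
  have -> : ((\pi_ThompsonF ((i, e) :: u))
      = Fmul (\pi_ThompsonF [:: (i, e)]) (\pi_ThompsonF u))%qT by rewrite Fmul_pi.
  rewrite big_cons IH; congr (Fmul _ _).
  case: e => //; exact: (Finv_pi [:: (i, false)]).
have [|A [B [red eAB _]]] := @length_path n [::] [::] s (fun _ => ltac:(by [])).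
  move=> _ /mapP[x xu ->]; apply: letter_is_gen.
  exact: (leq_bigmax_seq (F := fun x : letter => x.1)).
have [d [redd _ _ ed]] := reduced_diagram_of red.
by exists d; split=> //; rewrite ed eAB es /pair_elt /= mulgV mul1g.
Qed.

Lemma reduced_diagramP g :
  reduced (reduced_diagram g) /\ diagram_element (reduced_diagram g) = g.
Proof. exact: (classical_sets.xgetPex identity_diagram (exists_reduced_diagram g)). Qed.

Theorem theorem3p3 (n : nat) (hn : 1 <= n) (g : ThompsonF) :
  word_length n g = l_infty g + 2 * penalty_weight n g.
Proof.
have [red eg] := reduced_diagramP g.
rewrite /l_infty /penalty_weight; set d := reduced_diagram g in red eg *.
have [pw pw_min] := diagram_penalty_weightP n red.
have dP : is_diagram d by case: red.
rewrite diagram_elementE // in eg; have no_ear := reduced_no_common_ear red.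
have [s [sz gens es]] := length_le hn no_ear pw.
rewrite !nonright_caretsE -/(narcs (spine d.1) (spine d.2)) mul2n.
rewrite /word_length /word_length_for; set Q := fun k => exists s0, _.
have sQ : Q (size s) by exists s; split=> //; rewrite es.
have [|[t [tsz tgens et]] min] := @leastP Q; first by exists (size s).
apply/eqP; rewrite eqn_leq (leq_trans (min _ sQ) sz) /= -tsz.
(* The inverse word leads from the diagram of g to a pair without arcs. *)
pose t' := rev [seq (y^-1)%g | y <- t].
have prod_t' : (\prod_(y <- t') y)%g = (g^-1)%g.
  rewrite -et /t'; elim: (t) => [|y r IH]; first by rewrite !big_nil invg1.
  by rewrite /= rev_cons -cats1 big_cat big_seq1 big_cons IH invgM.
have [|A' [B' [red' e' w']]] := @length_path n _ _ t' no_ear.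
  by move=> y; rewrite mem_rev => /mapP[z /tgens zg ->]; apply: is_genV.
have arcs0 : narcs A' B' = 0 by apply: trivial_pair red' _; rewrite e' eg prod_t' mulgV.
have [|k pwk le_k] := w' 0.
  move/eqP: arcs0; rewrite /narcs addn_eq0 !size_eq0 => /andP[/eqP-> /eqP->].
  exists predn; first by split=> // y y0; rewrite /adj /edge prednK ?eqxx.
  by exists [::] => // w [[p /andP[_]]].
rewrite arcs0 size_rev size_map in le_k; apply: leq_trans le_k.
by rewrite leq_add2l leq_double pw_min.
Qed.
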